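(* Let $\beta\equiv\beta^{(4)}$ be a normalized nc sequence with a moment matrix $\mathcal M_2$ of rank 6 satisfying the column relation $\mathbb Y^2=\mathbf 1-\mathbb X^2$. For $a,b,c,d,e\in\mathbb R$ let $L(a,b,c,d,e)$ be the matrix (rows and columns indexed by $1,X,Y,X^2,XY,YX,Y^2$) $$\begin{pmatrix} a&\beta_X&\beta_Y&b&c&c&a-b\\ \beta_X&b&c&\beta_{X^3}&\beta_{X^2Y}&\beta_{X^2Y}&\beta_X-\beta_{X^3}\\ \beta_Y&c&a-b&\beta_{X^2Y}&\beta_X-\beta_{X^3}&\beta_X-\beta_{X^3}&\beta_Y-\beta_{X^2Y}\\ b&\beta_{X^3}&\beta_{X^2Y}&d&e&e&b-d\\ c&\beta_{X^2Y}&\beta_X-\beta_{X^3}&e&b-d&b-d&c-e\\ c&\beta_{X^2Y}&\beta_X-\beta_{X^3}&e&b-d&b-d&c-e\\ a-b&\beta_X-\beta_{X^3}&\beta_Y-\beta_{X^2Y}&b-d&c-e&c-e&a-2b+d \end{pmatrix}.$$ Then $\beta$ admits a nc measure if and only if there exist $a,b,c,d,e\in\mathbb R$ such that (1) $L(a,b,c,d,e)\succeq0$; (2) $\mathcal M_2-L(a,b,c,d,e)\succeq0$; (3) the principal submatrix of $\mathcal M_2-L(a,b,c,d,e)$ on the rows and columns indexed by $1,X,Y,XY$ is positive definite; (4) $\mathrm{rank}\,L(a,b,c,d,e)\le\mathrm{card}\,\mathcal V_L$, where $\mathcal V_L$ is the variety associated to the moment matrix $L(a,b,c,d,e)$.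
   Context: Words are elements of the free monoid on noncommuting letters $X,Y$; $|w|$ is the length of $w$, $w^*$ its reverse, and $v,w$ are cyclically equivalent if $v$ is a cyclic permutation of $w$. A sequence $\beta\equiv\beta^{(4)}=(\beta_w)_{|w|\le4}$ is a family of real numbers with $\beta_v=\beta_w$ for cyclically equivalent $v,w$ and $\beta_w=\beta_{w^*}$. It is normalized if $\beta_1=1$, and a nc sequence if $\beta_{X^2Y^2}\ne\beta_{XYXY}$. Its moment matrix $\mathcal M_2$ is the symmetric $7\times7$ matrix with rows and columns indexed by $1,X,Y,X^2,XY,YX,Y^2$ and $(U,V)$ entry $\beta_{U^*V}$; the column indexed by $w$ is denoted $w(\mathbb X,\mathbb Y)$, $\mathbf 1$ is the column indexed by the empty word, and ''satisfies a relation'' means that the corresponding linear relation between columns holds. $\succeq0$ means positive semidefinite. For a moment matrix $L$ whose columns $\mathbb X\mathbb Y$ and $\mathbb Y\mathbb X$ coincide, the variety associated to $L$ is $\mathcal V_L=\bigcap\{(x,y)\in\mathbb R^2: g(x,y)=0\}$, the intersection over all $g\in\mathbb R[x,y]$ of degree $\le2$ such that $g(\mathbb X,\mathbb Y)=\mathbf 0$ in the column space of $L$ (for $g=\sum a_{ij}x^iy^j$, $g(\mathbb X,\mathbb Y)=\sum a_{ij}\mathbb X^i\mathbb Y^j$). A representing measure for $\beta$ consists of finitely many pairs $(A_i,B_i)$ (atoms) of real symmetric $t_i\times t_i$ matrices ($t_i$ is the size) and numbers $\lambda_i>0$ with $\sum_i\lambda_i=1$ and $\beta_w=\sum_i\lambda_i\mathrm{Tr}(w(A_i,B_i))$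 for all $|w|\le4$, where $\mathrm{Tr}(A)=\frac1t\mathrm{tr}(A)$ for $A\in\mathbb R^{t\times t}$. It is of type $(m_1,\dots,m_r)$ if it has exactly $m_i$ atoms of size $i$ and $m_r\neq0$. It is minimal if no other representing measure has smaller type, where types are compared first by $r$, then by $m_r$, then $m_{r-1}$, ..., then $m_1$. $\beta$ admits a nc measure if it has a minimal representing measure of type $(m_1,\dots,m_r)$ with $r>1$. *)

(* Defs.v *)
From mathcomp Require Import all_boot all_order all_algebra.
From mathcomp Require Import mpoly classical_sets cardinality reals.

Set Implicit Arguments.
Unset Strict Implicit.
Unset Printing Implicit Defensive.

Import Order.TTheory GRing.Theory Num.Theory.
Local Open Scope ring_scope.

(* Words in the two noncommuting letters; the letters are encoded as booleans.
   The involution w^* is [rev], the empty word is [::]. *)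
Definition word := seq bool.
Definition lX : bool := false.
Definition lY : bool := true.

(* beta^(4) is a total function on words of which only the values at words of
   length at most 4 are ever used; [rot k w] ranges over the cyclic
   permutations of w. *)
Definition moment_sequence (R : realType) (beta : word -> R) : Prop :=
  forall w : word, (size w <= 4)%N ->
    (forall k : nat, beta (rot k w) = beta w) /\ beta (rev w) = beta w.

Definition normalized (R : realType) (beta : word -> R) : Prop :=
  beta [::] = 1.

Definition nc_sequence (R : realType) (beta : word -> R) : Prop :=
  beta [:: lX; lX; lY; lY] <> beta [:: lX; lY; lX; lY].

Definition basis : seq word :=
  [:: [::]; [:: lX]; [:: lY];
      [:: lX; lX]; [:: lX; lY]; [:: lY; lX]; [:: lY; lY]].

Definition M2 (R : realType) (beta : word -> R) : 'M[R]_7 :=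
  \matrix_(i, j) beta (rev (nth [::] basis i) ++ nth [::] basis j).

(* Meaningful for words of length at most 2, i.e. for w \in basis. *)
Definition idx (w : word) : 'I_7 := inord (index w basis).

Definition wcol (R : realType) (M : 'M[R]_7) (w : word) : 'cV[R]_7 :=
  col (idx w) M.

Definition principal_submx (R : realType) (s : seq word) (M : 'M[R]_7) :
    'M[R]_(size s) :=
  mxsub (fun i => idx (nth [::] s i)) (fun j => idx (nth [::] s j)) M.

Definition psd (R : realType) (n : nat) (M : 'M[R]_n) : Prop :=
  M^T = M /\ forall v : 'cV[R]_n, 0 <= (v^T *m M *m v) 0 0.

Definition posdef (R : realType) (n : nat) (M : 'M[R]_n) : Prop :=
  M^T = M /\ forall v : 'cV[R]_n, v != 0 -> 0 < (v^T *m M *m v) 0 0.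

(* g(X,Y) for a commutative polynomial g of degree at most 2; the variables of
   g are indexed by 0 (for x) and 1 (for y) in 'I_2. *)
Definition poly_col (R : realType) (L : 'M[R]_7) (g : {mpoly R[2]}) :
    'cV[R]_7 :=
  \sum_(m <- msupp g)
     g@_m *: wcol L (nseq (m ord0) lX ++ nseq (m ord_max) lY).

(* [msize g] is 1 + the total degree of g (and 0 for g = 0). *)
Definition variety (R : realType) (L : 'M[R]_7) : set (R * R) :=
  [set p : R * R | forall g : {mpoly R[2]}, (msize g <= 3)%N ->
     poly_col L g = 0 ->
     g.@[fun i : 'I_2 => if i == ord0 then p.1 else p.2] = 0]%classic.

Record atom (R : realType) := Atom {
  asize : nat;
  aweight : R;
  aX : 'M[R]_asize;
  aY : 'M[R]_asize }.

Definition wmx (R : realType) (t : nat) (A B : 'M[R]_t) (w : word) : 'M[R]_t :=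
  foldr (fun l P => (if l == lX then A else B) *m P) 1%:M w.

Definition ntr (R : realType) (t : nat) (A : 'M[R]_t) : R := \tr A / t%:R.

Definition atom_wf (R : realType) (u : atom R) : Prop :=
  [/\ (0 < asize u)%N, 0 < aweight u, (aX u)^T = aX u & (aY u)^T = aY u].

Definition represents (R : realType) (mu : seq (atom R)) (beta : word -> R) :
    Prop :=
  [/\ forall i : 'I_(size mu), atom_wf (tnth (in_tuple mu) i),
      \sum_(u <- mu) aweight u = 1 &
      forall w : word, (size w <= 4)%N ->
        beta w = \sum_(u <- mu) aweight u * ntr (wmx (aX u) (aY u) w)].

(* The type (m_1, ..., m_r) is the sequence m with m_i = nth 0 m i.-1, so
   r = size m; the first condition also excludes atoms of size > r. *)
Definition has_type (R : realType) (mu : seq (atom R)) (m : seq nat) : Prop :=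
  (forall i : nat, count (fun u => asize u == i.+1) mu = nth 0%N m i) /\
  last 0%N m <> 0%N.

Definition type_lt (m m' : seq nat) : Prop :=
  (size m < size m')%N \/
  size m = size m' /\
  exists k : nat, [/\ (k < size m)%N, (nth 0%N m k < nth 0%N m' k)%N &
    forall j : nat, (k < j < size m)%N -> nth 0%N m j = nth 0%N m' j].

Definition minimal_measure (R : realType) (mu : seq (atom R)) (m : seq nat)
    (beta : word -> R) : Prop :=
  [/\ represents mu beta, has_type mu m &
      forall (mu' : seq (atom R)) (m' : seq nat),
        represents mu' beta -> has_type mu' m' -> ~ type_lt m' m].

Definition admits_nc_measure (R : realType) (beta : word -> R) : Prop :=
  exists (mu : seq (atom R)) (m : seq nat),
    minimal_measure mu m beta /\ (1 < size m)%N.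

Definition Lmx (R : realType) (beta : word -> R) (a b c d e : R) : 'M[R]_7 :=
  let x := beta [:: lX] in
  let y := beta [:: lY] in
  let xxx := beta [:: lX; lX; lX] in
  let xxy := beta [:: lX; lX; lY] in
  \matrix_(i, j) nth 0 (nth [::]
    [:: [:: a;     x;       y;       b;     c;       c;       a - b];
        [:: x;     b;       c;       xxx;   xxy;     xxy;     x - xxx];
        [:: y;     c;       a - b;   xxy;   x - xxx; x - xxx; y - xxy];
        [:: b;     xxx;     xxy;     d;     e;       e;       b - d];
        [:: c;     xxy;     x - xxx; e;     b - d;   b - d;   c - e];
        [:: c;     xxy;     x - xxx; e;     b - d;   b - d;   c - e];
        [:: a - b; x - xxx; y - xxy; b - d; c - e;   c - e;   a - b *+ 2 + d]
    ] i) j.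

(* Main.v *)
From mathcomp Require Import all_boot all_order all_algebra.
From mathcomp Require Import mpoly boolp classical_sets functions cardinality reals.
From mathcomp Require Import complex ring lra zify.
Require Import Defs.

Set Implicit Arguments.
Unset Strict Implicit.
Unset Printing Implicit Defensive.

Import Order.TTheory GRing.Theory Num.Theory.
Local Open Scope ring_scope.
Local Open Scope sesquilinear_scope.

(* In every representing measure the atoms satisfy A^2 + B^2 = 1, so C = AB - BA
   anticommutes with A and B, and the orthogonal projection P onto ker C commutes with
   them. Compressing the traces by P gives the commutative part L; on the complement
   all words of odd length have trace 0, which is why L and beta share their odd moments.
   Conversely, L >= 0 has a measure on the unit circle by the Caratheodory-Toeplitz
   theorem. The moments of M_2 - L come from a measure on the disk ga^2 <= al (1 - al),
   whose points are the 2 x 2 pairs with A^2 = al, AB + BA = 2 ga: quadratic moments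
   with psd moment matrix and nonnegative localizing scalar, here E(al - al^2 - ga^2),
   are represented on a disk. As beta_{X^2Y^2} <> beta_{XYXY}, that scalar is positive,
   whence (3); the points of a circle measure of L lie in V_L, whence (4). *)

(** * Positive semidefinite Toeplitz matrices *)

(** Atoms obey A^2 + B^2 = 1 because the weighted mean of the normalized traces of (1 - A^2 - B^2)^2
    is a combination of moments that the column relation makes 0. Hence A^2 = 1 - B^2 commutes with
    B, so AC + CA = A^2 B - B A^2 = 0, and similarly for B. Since L carries all odd moments, the
    rest is determined by its moments at 1, X^2, XY, X^4, X^3Y and XYXY. On a pair with A^2 = al and
    AB + BA = 2 ga these are 1, al, ga, al^2, al ga and 2 ga^2 - al (1 - al): a tracial problem of
    degree 4 becomes a quadratic moment problem in the plane. The commutative part cancels in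
    beta_{X^2Y^2} - beta_{XYXY}, so this difference is twice the localizing scalar of the rest. Its
    strict positivity gives room for the disk measure: the barycentre is interior and keeps positive
    mass. For minimality it is enough to have some measure: a smallest type then exists, and atoms
    of size 1 alone would make beta_{X^2Y^2} and beta_{XYXY} equal. *)

Definition hform (C : numClosedFieldType) n (T : 'M[C]_n) (x y : 'cV[C]_n) : C :=
  (x ^t* *m T *m y) 0 0.

Definition hpsd (C : numClosedFieldType) n (T : 'M[C]_n) : Prop :=
  T ^t* = T /\ forall x, 0 <= hform T x x.

Lemma trmxC_mul (C : numClosedFieldType) m n p (A : 'M[C]_(m, n)) (B : 'M[C]_(n, p)) :
  (A *m B) ^t* = B ^t* *m A ^t*.
Proof. by rewrite trmx_mul map_mxM. Qed.

Lemma hformDr (C : numClosedFieldType) n (T : 'M[C]_n) x y z :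
  hform T x (y + z) = hform T x y + hform T x z.
Proof. by rewrite /hform mulmxDr mxE. Qed.

Lemma hformZr (C : numClosedFieldType) n (T : 'M[C]_n) a x y :
  hform T x (a *: y) = a * hform T x y.
Proof. by rewrite /hform -scalemxAr mxE. Qed.

Lemma hformDl (C : numClosedFieldType) n (T : 'M[C]_n) x y z :
  hform T (x + y) z = hform T x z + hform T y z.
Proof. by rewrite /hform linearD map_mxD !mulmxDl mxE. Qed.

Lemma hformZl (C : numClosedFieldType) n (T : 'M[C]_n) a x y :
  hform T (a *: x) y = a^* * hform T x y.
Proof. by rewrite /hform linearZ map_mxZ -!scalemxAl mxE. Qed.

Lemma hformC (C : numClosedFieldType) n (T : 'M[C]_n) x y :
  T ^t* = T -> hform T y x = (hform T x y)^*.
Proof.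
move=> hT; have -> : (hform T x y)^* = ((x ^t* *m T *m y) ^t*) 0 0.
  by rewrite [RHS]mxE [in RHS]mxE.
by rewrite !trmxC_mul hT trmxCK mulmxA.
Qed.

Lemma hpsd_CauchySchwarz (C : numClosedFieldType) n (T : 'M[C]_n) x y :
  hpsd T -> `|hform T x y| ^+ 2 <= hform T x x * hform T y y.
Proof.
move=> [hT T0]; rewrite normCK.
set al := hform T x x; set be := hform T x y; set ga := hform T y y.
have alR : al^* = al by rewrite -hformC.
have yx : hform T y x = be^* by rewrite -hformC.
have expand a b : hform T (a *: y + b *: x) (a *: y + b *: x) =
    a * a^* * ga + a^* * b * be^* + a * b^* * be + b * b^* * al.
  by rewrite !(hformDl, hformDr) !(hformZl, hformZr) yx -/al -/be -/ga; ring.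
have [al0|al_neq0] := eqVneq al 0.
  have h t : t^* = t -> 0 <= ga - (t * (be * be^*)) *+ 2.
    move=> tR; have := T0 (1 *: y + (- (t * be)) *: x).
    rewrite expand al0 rmorphN rmorphM /= tR rmorph1.
    by congr (_ <= _); ring.
  rewrite al0 mul0r; have [->//|be_neq0] := eqVneq (be * be^*) 0.
  have be0 : 0 < be * be^* by rewrite lt0r be_neq0 mul_conjC_ge0.
  have bb_real : (be * be^*)^* = be * be^* by rewrite rmorphM /= conjCK mulrC.
  have gaR : ga^* = ga by rewrite -hformC.
  (* This t turns ga - 2 t |be|^2 into - ga - 2, which is negative. *)
  have := h ((ga + 1) / (be * be^*)).
  rewrite divfK ?gt_eqF // rmorphM fmorphV /= bb_real rmorphD /= gaR rmorph1.
  move=> /(_ erefl).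
  have -> : ga - (ga + 1) *+ 2 = - (ga + 2) by ring.
  rewrite oppr_ge0 => ga2_le0; have ga2_gt0 : 0 < ga + 2.
    by apply: ltr_wpDl; rewrite ?T0 // ltr0n.
  by have := lt_le_trans ga2_gt0 ga2_le0; rewrite ltxx.
have al_gt0 : 0 < al by rewrite lt0r al_neq0 T0.
have := T0 (al *: y + (- be) *: x).
rewrite expand alR rmorphN /=.
have -> : al * al * ga + al * - be * be^* + al * - be^* * be + - be * - be^* * al
  = al * (al * ga - be * be^*) by ring.
by rewrite pmulr_rge0 // subr_ge0.
Qed.

(** By Cauchy-Schwarz against the basis vectors, a null vector x of the form makes every entry of
    [T *m x] vanish. *)
Lemma hpsd_ker (C : numClosedFieldType) n (T : 'M[C]_n) x :
  hpsd T -> (hform T x x == 0) = (T *m x == 0).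
Proof.
move=> hT; apply/eqP/eqP => [xx0|Tx0]; last first.
  by rewrite /hform -mulmxA Tx0 mulmx0 mxE.
apply/matrixP => i j; rewrite (ord1 j) [RHS]mxE.
have := hpsd_CauchySchwarz (delta_mx i 0) x hT; rewrite xx0 mulr0.
have -> : hform T (delta_mx i 0) x = (T *m x) i 0.
  rewrite /hform trmx_delta map_delta_mx -mulmxA mxE (bigD1 i) //= big1.
    by rewrite mxE !eqxx mul1r addr0.
  by move=> k; rewrite mxE eqxx /= => /negPf->; rewrite mul0r.
move=> le0; apply/eqP; rewrite -normr_eq0 -sqrf_eq0 eq_le le0 /=.
by rewrite exprn_ge0.
Qed.

(** Write r = D T and let w be the value of the form at the adjoint of D. Subtracting r* r / w keeps
    the form nonnegative by Cauchy-Schwarz, and the difference kills the adjoint of D, which T sends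
    to r* != 0; so the rank drops. *)
Lemma hpsd_deflate (C : numClosedFieldType) n (T : 'M[C]_n) (r : 'rV[C]_n) :
  hpsd T -> r != 0 -> (r <= T)%MS ->
  exists2 w : C, 0 < w & hpsd (T - w *: (r ^t* *m r)) /\
                 (\rank (T - w *: (r ^t* *m r))%R < \rank T)%N.
Proof.
move=> hT r0 /submxP[D rD]; have [hTh T0] := hT.
have rE y : (r *m y) 0 0 = hform T (D ^t*) y by rewrite /hform trmxCK -rD.
have rtE : r ^t* = T *m D ^t* by rewrite rD trmxC_mul hTh.
set w := hform T (D ^t*) (D ^t*).
have w0 : 0 < w.
  rewrite lt0r T0 andbT hpsd_ker // -rtE; apply: contra_neq r0 => rt0.
  by rewrite -[r]trmxCK rt0 trmx0 map_mx0.
exists w^-1; first by rewrite invr_gt0.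
have wR : (w^-1)^* = w^-1 by rewrite fmorphV /= /w -hformC.
have hT' : hpsd (T - w^-1 *: (r ^t* *m r)).
  split=> [|y].
    by rewrite linearB linearZ map_mxB map_mxZ /= wR hTh trmxC_mul trmxCK.
  rewrite /hform mulmxBr mulmxBl -scalemxAr -scalemxAl mxE [X in _ + X]mxE.
  rewrite [X in - X]mxE -/(hform T y y).
  have -> : (y ^t* *m (r ^t* *m r) *m y) 0 0 = `|hform T (D ^t*) y| ^+ 2.
    rewrite normCK -rE (_ : _ *m y = (r *m y) ^t* *m (r *m y)); last first.
      by rewrite trmxC_mul !mulmxA.
    rewrite [in LHS]mxE big_ord_recl big_ord0 addr0 mulrC; congr (_ * _).
    by rewrite !mxE.
  rewrite subr_ge0 ler_pdivrMl //.
  exact: hpsd_CauchySchwarz.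
split=> //; apply: rank_ltmx; rewrite /ltmx; apply/andP; split.
  have -> : T - w^-1 *: (r ^t* *m r) = (1%:M - w^-1 *: (r ^t* *m D)) *m T.
    by rewrite mulmxBl mul1mx -scalemxAl -mulmxA -rD.
  exact: submxMl.
apply/negP => /submxP[M TM].
have : T *m D ^t* = 0.
  rewrite TM -mulmxA mulmxBl -scalemxAl -(mulmxA _ r).
  have -> : r *m D ^t* = w%:M.
    by apply/matrixP => i j; rewrite !ord1 rE !mxE mulr1n.
  by rewrite mul_mx_scalar scalerA mulVf ?gt_eqF // scale1r -rtE subrr mulmx0.
rewrite -rtE => rt0; move: r0; rewrite -[r]trmxCK rt0 trmx0 map_mx0.
by rewrite eqxx.
Qed.

Definition toeplitz (C : numClosedFieldType) m (T : 'M[C]_m) : Prop :=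
  forall i j i' j' : 'I_m, i' = i.+1 :> nat -> j' = j.+1 :> nat -> T i' j' = T i j.

(** Pairing this row with a coefficient vector evaluates the polynomial at z, so it lies in the row
    space of T exactly when z is a common root of the polynomials in the kernel of T. *)
Definition powrow (C : numClosedFieldType) m (z : C) : 'rV[C]_m := \row_k z ^+ k.

Lemma powrow_poly (C : numClosedFieldType) m (z : C) (p : {poly C}) :
  (size p <= m)%N -> powrow m z *m (poly_rV p)^T = p.[z]%:M.
Proof.
move=> sp; apply/matrixP => i j; rewrite !ord1 !mxE (horner_coef_wide _ sp).
by apply: eq_bigr => k _; rewrite !mxE mulrC.
Qed.

(** Shifting both summation indices by one leaves the entries of T fixed; the bound on [size p]
    keeps the shifted coefficients within n+1 places. *)
Lemma toeplitz_shift (C : numClosedFieldType) n (T : 'M[C]_n.+1) (p : {poly C}) :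
  toeplitz T -> (size p <= n)%N ->
  hform T (poly_rV (p * 'X))^T (poly_rV (p * 'X))^T =
  hform T (poly_rV p)^T (poly_rV p)^T.
Proof.
move=> tT sp.
have hE q : hform T (poly_rV q)^T (poly_rV q)^T =
    \sum_(i < n.+1) \sum_(j < n.+1) (q`_i)^* * T i j * q`_j.
  rewrite /hform mxE exchange_big; apply: eq_bigr => j _.
  rewrite !mxE mulr_suml; apply: eq_bigr => i _; by rewrite !mxE.
rewrite !hE big_ord_recl [RHS]big_ord_recr /=.
rewrite big1 ?add0r => [|j _]; last by rewrite coefMX conjC0 !mul0r.
rewrite [X in _ = _ + X]big1 ?addr0 => [|j _]; last first.
  by rewrite (nth_default _ sp) conjC0 !mul0r.
apply: eq_bigr => i _; rewrite big_ord_recl [RHS]big_ord_recr /=.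
rewrite !coefMX /= mulr0 add0r (nth_default _ sp) mulr0 addr0.
apply: eq_bigr => j _; rewrite coefMX /=; congr (_ * _ * _).
exact: tT.
Qed.

Lemma toeplitz_psd0 (C : numClosedFieldType) n (T : 'M[C]_n.+1) :
  hpsd T -> toeplitz T -> T 0 0 = 0 -> T = 0.
Proof.
move=> hT tT T00.
have Td (i : 'I_n.+1) : T i i = 0.
  case: i => k; elim: k => [|k IH] lt_k.
    by rewrite -[RHS]T00; congr (T _ _); apply: val_inj.
  by rewrite (tT (Ordinal (ltnW lt_k)) (Ordinal (ltnW lt_k))).
apply/matrixP => i j; rewrite [RHS]mxE.
have /eqP : hform T (delta_mx j 0) (delta_mx j 0) == 0.
  rewrite /hform trmx_delta map_delta_mx -mulmxA -colE -rowE !mxE; exact/eqP/Td.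
move=> /eqP; rewrite hpsd_ker // -colE => /eqP /matrixP /(_ i 0).
by rewrite !mxE.
Qed.

(* Multiplication by X is isometric for the form of T, so a root z of a polynomial
   q = (X - z) h of least degree in the kernel has |z| = 1; moreover q divides the
   whole kernel. *)
Lemma toeplitz_ker_root (C : numClosedFieldType) n (T : 'M[C]_n.+1) :
  hpsd T -> toeplitz T -> T != 0 ->
  exists2 z : C, z * z^* = 1 & (powrow n.+1 z <= T)%MS.
Proof.
move=> hT tT T0.
pose K (p : {poly C}) := (size p <= n.+1)%N /\ T *m (poly_rV p)^T = 0.
(* [K] is the set of null vectors of the form, and multiplication by X preserves the form as long as
   the degree allows it. *)
have KX p : K p -> (size p <= n)%N -> K (p * 'X).
  move=> [_ Kp] sp; split; first by rewrite (leq_trans (size_polyMleq _ _)) // size_polyX addn2.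
  by apply/eqP; rewrite -hpsd_ker // toeplitz_shift // hpsd_ker // Kp.
have KZ a p : K p -> K (a *: p).
  move=> [sp Kp]; split; first exact: leq_trans (size_scale_leq _ _) sp.
  by rewrite linearZ linearZ /= -scalemxAr Kp scaler0.
have KD p q : K p -> K q -> K (p + q).
  move=> [sp Kp] [sq Kq]; split.
    by rewrite (leq_trans (size_polyD _ _)) // geq_max sp sq.
  by rewrite linearD linearD /= mulmxDr Kp Kq addr0.
have KM (s q : {poly C}) : K q -> (size (s * q)%R <= n.+1)%N -> K (s * q).
  move=> Kq; elim/poly_ind: s => [|s c IH].
    by rewrite mul0r => _; rewrite -(scale0r q); exact: KZ.
  have [->|q0] := eqVneq q 0.
    by rewrite mulr0 => _; rewrite -(scale0r q); exact: KZ.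
  have [->|s0] := eqVneq s 0.
    by rewrite mul0r add0r mul_polyC => _; apply: KZ.
  have sz : size (s * 'X + c%:P) = (size s).+1.
    by rewrite size_MXaddC (negPf s0).
  rewrite size_mul // ?sz /=; last by rewrite -size_poly_eq0 sz.
  move=> ssq; rewrite mulrDl mul_polyC; apply: KD; last exact: KZ.
  have szsq : (size (s * q)%R <= n)%N.
    by rewrite size_mul //; move: ssq; case: (size s + size q)%N.
  by rewrite mulrAC; apply: KX => //; apply: IH; exact: leqW.
suff [z z1 zK] : exists2 z : C, z * z^* = 1 & forall p, K p -> p.[z] = 0.
  exists z => //; rewrite submxE; apply/eqP/matrixP => i j; rewrite ord1 [RHS]mxE.
  set v := col j (cokermx T).
  have vE : (poly_rV (rVpoly v^T))^T = v by rewrite rVpolyK trmxK.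
  have /zK z0 : K (rVpoly v^T).
    split; first exact: size_poly.
    by rewrite vE /v colE mulmxA mulmx_coker mul0mx.
  have : powrow n.+1 z *m v = 0.
    by rewrite -vE powrow_poly ?size_poly // z0 raddf0.
  by rewrite /v colE mulmxA -colE => /matrixP /(_ 0 0); rewrite !mxE.
(* With a trivial kernel every z on the unit circle qualifies; 1 is taken. *)
have [kerP|kerN] := pselect (exists p, K p /\ p != 0); last first.
  exists 1; first by rewrite rmorph1 mulr1.
  move=> p Kp; have [->|p0] := eqVneq p 0; first by rewrite horner0.
  by case: kerN; exists p.
have kex : exists k, `[< exists p, [/\ K p, p != 0 & size p = k] >].
  by have [p [Kp p0]] := kerP; exists (size p); apply/asboolP; exists p.
case: (ex_minnP kex) => k /asboolP[q [Kq q0 szq]] kmin.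
have minq p : K p -> (size p < size q)%N -> p = 0.
  move=> Kp; have [//|p0] := eqVneq p 0.
  rewrite ltnNge szq kmin //; apply/asboolP; by exists p.
have szq1 : size q != 1%N.
  apply/negP => /size_poly1P[c c0 qE]; move/negP: T0; apply.
  apply/eqP/toeplitz_psd0 => //; have [_ /matrixP/(_ 0 0)] := Kq.
  rewrite qE !mxE big_ord_recl big1 => [|i _]; last first.
    by rewrite !mxE coefC; exact: mulr0.
  by rewrite !mxE coefC /= addr0 => /eqP; rewrite mulf_eq0 (negPf c0) orbF => /eqP.
have [z /factor_theorem[h qE]] := closed_rootP q szq1.
have h0 : h != 0 by apply: contra_neq q0 => h0; rewrite qE h0 mul0r.
have szh : size q = (size h).+1 by rewrite qE size_Mmonic ?monicXsubC // size_XsubC addn2.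
have szhn : (size h <= n)%N by case: Kq; rewrite szh.
exists z; last first.
  move=> p Kp; rewrite (divp_eq p q).
  have Kpq : K (p %/ q * q).
    apply: KM => //.
    have -> : p %/ q * q = p - p %% q by rewrite {2}(divp_eq p q) addrK.
    rewrite (leq_trans (size_polyD _ _)) // geq_max size_polyN (proj1 Kp) /=.
    by apply: ltnW; rewrite (leq_trans _ (proj1 Kq)) // ltn_modp.
  have -> : p %% q = 0.
    apply: minq; last by rewrite ltn_modp.
    have -> : p %% q = p + (-1) *: (p %/ q * q).
      by rewrite scaleN1r {2}(divp_eq p q) addrC addKr.
    by apply: KD => //; exact: KZ.
  by rewrite addr0 hornerM {2}qE hornerM hornerXsubC subrr !mulr0.
(* As Xh - zh = q is in the kernel, T sends Xh to z T h, so the form at Xh is |z|^2 times the form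
   at h. The shift makes the two values equal, and the value at h is nonzero because h is too short
   to lie in [K]. *)
pose u : 'cV[C]_n.+1 := (poly_rV (h * 'X))^T; pose v : 'cV[C]_n.+1 := (poly_rV h)^T.
have hvv : hform T v v != 0.
  rewrite hpsd_ker //; apply: contra_neq h0 => Tv0.
  by apply: minq; [split=> //; exact: leqW | rewrite szh].
have uz : T *m u = z *: (T *m v).
  have [_] := Kq; rewrite qE mulrBr [h * z%:P]mulrC mul_polyC 2!linearB 2!linearZ /=.
  by rewrite mulmxBr -scalemxAr => /eqP; rewrite subr_eq0 => /eqP.
have zr x : hform T x u = z * hform T x v.
  by rewrite /hform -!mulmxA uz -scalemxAr mxE.
have hTh := proj1 hT.
have uu : hform T u u = hform T v v by exact: toeplitz_shift.
apply: (mulIf hvv); rewrite mul1r -[RHS]uu zr (hformC v u hTh) zr.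
by rewrite rmorphM /= -(hformC v v hTh) mulrA.
Qed.

(** Induction on the rank, splitting off one atom at a time. For |z| = 1 the entry conj(z^i) z^j
    depends on j - i only, so deflation along [powrow] leaves a Toeplitz matrix. *)
Theorem toeplitz_psd_measure (C : numClosedFieldType) n (T : 'M[C]_n.+1) :
  hpsd T -> toeplitz T ->
  exists s : seq (C * C), [/\ forall u, u \in s -> 0 < u.1 /\ u.2 * u.2^* = 1 &
    forall i j, T i j = \sum_(u <- s) u.1 * ((u.2 ^+ i)^* * u.2 ^+ j)].
Proof.
have [k] := ubnP (\rank T); elim: k T => // k IH T rk hT tT.
have [->|T0] := eqVneq T 0.
  by exists [::]; split=> // i j; rewrite big_nil mxE.
have [z z1 zT] := toeplitz_ker_root hT tT T0.
have [|w w0 [hT' rk']] := hpsd_deflate hT _ zT.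
  by apply/eqP => /rowP/(_ 0); rewrite !mxE expr0 => /eqP; rewrite oner_eq0.
have zzE i j : ((powrow n.+1 z) ^t* *m powrow n.+1 z) i j = (z ^+ i)^* * z ^+ j.
  by rewrite !mxE big_ord_recl big_ord0 addr0 !mxE.
have [||s [s1 s2]] := IH _ _ hT'.
- exact: leq_trans rk' rk.
- move=> i j i' j' ei ej; rewrite !mxE (tT i j) //; congr (_ - _ * _).
  move: (zzE i' j') (zzE i j); rewrite !mxE => -> ->.
  by rewrite ei ej !exprS rmorphM mulrACA [z^* * z]mulrC z1 mul1r.
exists ((w, z) :: s); split=> [u|i j].
  by rewrite inE => /predU1P[->|/s1].
rewrite big_cons -s2 -zzE /= [X in _ = _ + X]mxE [X in _ = _ + (_ + X)]mxE.
by rewrite [X in _ = _ + (_ - X)]mxE addrC subrK.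
Qed.

(** At u + iv with u, v real the form is the sum of its values at u and v; the cross terms cancel by
    symmetry. *)
Lemma hpsd_real (R : realType) n (L : 'M[R]_n) :
  psd L -> hpsd (map_mx (real_complex R) L : 'M[R[i]]_n).
Proof.
move=> [LT L0]; split.
  apply/matrixP => i j; rewrite -[in RHS]LT !mxE.
  by rewrite /Num.conj /= oppr0.
move=> x; set LC := map_mx _ L.
have realE (u v : 'cV[R]_n) : hform LC (map_mx (real_complex R) u)
    (map_mx (real_complex R) v) = ((u^T *m L *m v) 0 0)%:C%C.
  rewrite /hform; have -> : (map_mx (real_complex R) u) ^t* = map_mx (real_complex R) u^T.
    by apply/matrixP => i j; rewrite !mxE /Num.conj /= oppr0.
  by rewrite -!map_mxM mxE.
pose u := map_mx (@complex.Re R) x; pose v := map_mx (@complex.Im R) x.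
have -> : x = map_mx (real_complex R) u + 'i%C *: map_mx (real_complex R) v.
  by apply/matrixP => i j; rewrite !mxE -complexE.
have sym : (v^T *m L *m u) 0 0 = (u^T *m L *m v) 0 0.
  by rewrite -[v^T *m L *m u]trmxK mxE !trmx_mul trmxK LT mulmxA.
rewrite hformDl !hformDr !hformZl !hformZr !realE sym.
have -> : ('i%C : R[i])^* = - 'i%C by rewrite /Num.conj /=; simpc.
set t := (_ 0 0)%:C%C; set t' := (_ 0 0)%:C%C; set t'' := (_ 0 0)%:C%C.
rewrite [leRHS](_ : _ = t - 'i%C ^+ 2 * t''); last by ring.
by rewrite sqr_i mulN1r opprK /t /t'' -rmorphD /= ler0c addr_ge0.
Qed.

(** * Measures on the circle *)

(* Column k holds the coefficients of z^(k-2) on the monomials indexing the moment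
   matrix, for z = x + iy on the unit circle. *)
Definition circle_coef (R : realType) : 'M[R[i]]_(7, 5) :=
  \matrix_(i, k) nth 0 (nth [::]
   [:: [:: -1;         0;          1; 0;          -1];
       [:: 0;          1;          0; 1;          0];
       [:: 0;          Complex 0 (-1); 0; Complex 0 1; 0];
       [:: 2;         0;          0; 0;          2];
       [:: Complex 0 (-2); 0;          0; 0;          Complex 0 2]] i) k.

(* The moments of z^k, by the multiple-angle formulas for z = cos t + i sin t. *)
Definition trig_moment (R : realType) (beta : word -> R) (a b c d e : R) (k : nat) : R[i] :=
  nth 0 [:: Complex a 0; Complex (beta [:: lX]) (beta [:: lY]);
    Complex (b *+ 2 - a) (c *+ 2);
    Complex (beta [:: lX; lX; lX] *+ 4 - beta [:: lX] *+ 3)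
            (beta [:: lX; lX; lY] *+ 4 - beta [:: lY]);
    Complex (d *+ 8 - b *+ 8 + a) (e *+ 8 - c *+ 4)] k.

Lemma sum7 (V : nmodType) (F : 'I_7 -> V) :
  \sum_i F i = F (inord 0) + F (inord 1) + F (inord 2) + F (inord 3) + F (inord 4) +
     F (inord 5) + F (inord 6).
Proof.
rewrite !big_ord_recl big_ord0 addr0 !addrA.
by do !congr (_ + _); congr F; apply: val_inj; rewrite /= inordK.
Qed.

Lemma circle_coefr (R : realType) m (M : 'M[R[i]]_(m, 7)) i (k : 'I_5) :
  (M *m circle_coef R) i k = nth 0
    [:: M i (inord 3) *+ 2 - M i (inord 0) - Complex 0 2 * M i (inord 4);
        M i (inord 1) - Complex 0 1 * M i (inord 2);
        M i (inord 0);
        M i (inord 1) + Complex 0 1 * M i (inord 2);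
        M i (inord 3) *+ 2 - M i (inord 0) + Complex 0 2 * M i (inord 4)] k.
Proof.
rewrite mxE sum7 !mxE !inordK //=.
have cN x : Complex 0 (- x) = - Complex 0 x :> R[i].
  by apply/eqP; rewrite eq_complex /= oppr0 !eqxx.
by case: k => [[|[|[|[|[|//]]]]] lk] /=; rewrite ?cN; ring.
Qed.

Lemma circle_coefl (R : realType) m (M : 'M[R[i]]_(7, m)) (k : 'I_5) i :
  ((circle_coef R) ^t* *m M) k i = nth 0
    [:: M (inord 3) i *+ 2 - M (inord 0) i + Complex 0 2 * M (inord 4) i;
        M (inord 1) i + Complex 0 1 * M (inord 2) i;
        M (inord 0) i;
        M (inord 1) i - Complex 0 1 * M (inord 2) i;
        M (inord 3) i *+ 2 - M (inord 0) i - Complex 0 2 * M (inord 4) i] k.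
Proof.
rewrite mxE sum7 !mxE !inordK //=.
have cJ x : (Complex 0 x)^* = - Complex 0 x :> R[i].
  by apply/eqP; rewrite eq_complex /= oppr0 !eqxx.
have cN x : Complex 0 (- x) = - Complex 0 x :> R[i].
  by apply/eqP; rewrite eq_complex /= oppr0 !eqxx.
case: k => [[|[|[|[|[|//]]]]] lk] /=.
all: by rewrite ?conjC0 ?rmorphN ?conjC1 ?rmorph_nat ?cJ ?cN; ring.
Qed.

(** On the unit circle conj(z^(j-2)) z^(k-2) = z^(k-j), so the form of L on the powers of z depends
    on k - j only. *)
Lemma circle_toeplitz (R : realType) (beta : word -> R) (a b c d e : R) (j k : 'I_5) :
  ((circle_coef R) ^t* *m map_mx (real_complex R) (Lmx beta a b c d e) *m circle_coef R) j k
  = if (j <= k)%N then trig_moment beta a b c d e (k - j)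
    else (trig_moment beta a b c d e (j - k))^*.
Proof.
rewrite circle_coefr.
case: k => [[|[|[|[|[|//]]]]] lk]; rewrite [nth _ _ _]/= !circle_coefl;
case: j => [[|[|[|[|[|//]]]]] lj].
all: rewrite /= !mxE /= !inordK //= /trig_moment /Num.conj /=.
all: apply/eqP; rewrite eq_complex /=; apply/andP; split; apply/eqP.
all: ring.
Qed.

Definition circle_mon (R : realType) (p : R * R) : 'cV[R]_7 :=
  \col_i nth 0 [:: 1; p.1; p.2; p.1 ^+ 2; p.1 * p.2; p.1 * p.2; p.2 ^+ 2] i.

Definition point_moment (R : realType) (p : R * R) (w : word) : R :=
  p.1 ^+ count_mem lX w * p.2 ^+ count_mem lY w.

(** A certificate rule: an identity modulo the relation p = q is reduced to [ring] by supplying the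
    cofactor k. *)
Lemma lincomb (R : comPzRingType) (k p q A B : R) : p = q -> A - B = k * (p - q) -> A = B.
Proof. by move=> ->; rewrite subrr mulr0 => /eqP; rewrite subr_eq0 => /eqP. Qed.

Lemma Lmx_point (R : realType) (p : R * R) : p.1 ^+ 2 + p.2 ^+ 2 = 1 ->
  circle_mon p *m (circle_mon p)^T =
  Lmx (point_moment p) 1 (p.1 ^+ 2) (p.1 * p.2) (p.1 ^+ 4) (p.1 ^+ 3 * p.2).
Proof.
case: p => x y /= h.
apply/matrixP => i j; rewrite !mxE big_ord_recl big_ord0 !mxE /= /point_moment /=.
case: i => [[|[|[|[|[|[|[|//]]]]]]] li]; case: j => [[|[|[|[|[|[|[|//]]]]]]] lj];
rewrite /=; by [ring | apply: (lincomb (k := 1) h); ring | apply: (lincomb (k := x) h); ring |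
  apply: (lincomb (k := y) h); ring | apply: (lincomb (k := x ^+ 2) h); ring |
  apply: (lincomb (k := x * y) h); ring | apply: (lincomb (k := y ^+ 2 + 1 - x ^+ 2) h); ring].
Qed.

Lemma Lmx_lin (R : realType) (w : R) (F G : word -> R) a b c d e a' b' c' d' e' :
  Lmx (fun v => w * F v + G v) (w * a + a') (w * b + b') (w * c + c') (w * d + d') (w * e + e')
  = w *: Lmx F a b c d e + Lmx G a' b' c' d' e'.
Proof.
apply/matrixP => i j; rewrite !mxE.
by case: i => [[|[|[|[|[|[|[|//]]]]]]] li]; case: j => [[|[|[|[|[|[|[|//]]]]]]] lj];
rewrite /=; ring.
Qed.

Lemma Lmx_circle (R : realType) (s : seq (R * (R * R))) :
  (forall u, u \in s -> u.2.1 ^+ 2 + u.2.2 ^+ 2 = 1) ->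
  Lmx (fun v => \sum_(u <- s) u.1 * point_moment u.2 v) (\sum_(u <- s) u.1 * 1)
    (\sum_(u <- s) u.1 * u.2.1 ^+ 2) (\sum_(u <- s) u.1 * (u.2.1 * u.2.2))
    (\sum_(u <- s) u.1 * u.2.1 ^+ 4) (\sum_(u <- s) u.1 * (u.2.1 ^+ 3 * u.2.2)) =
  \sum_(u <- s) u.1 *: (circle_mon u.2 *m (circle_mon u.2)^T).
Proof.
elim: s => [_|u s IH hs].
  rewrite !big_nil; apply/matrixP => i j; rewrite !mxE !big_nil.
  by case: i => [[|[|[|[|[|[|[|//]]]]]]] li]; case: j => [[|[|[|[|[|[|[|//]]]]]]] lj];
  rewrite /=; ring.
rewrite !big_cons -IH => [|v vs]; last by apply: hs; rewrite inE vs orbT.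
rewrite Lmx_point; last by apply: hs; rewrite mem_head.
rewrite -Lmx_lin; congr Lmx; apply: funext => v; exact: big_cons.
Qed.

Lemma eq_Lmx (R : realType) (F G : word -> R) a b c d e :
  F [:: lX] = G [:: lX] -> F [:: lY] = G [:: lY] ->
  F [:: lX; lX; lX] = G [:: lX; lX; lX] -> F [:: lX; lX; lY] = G [:: lX; lX; lY] ->
  Lmx F a b c d e = Lmx G a b c d e.
Proof. by rewrite /Lmx => -> -> -> ->. Qed.

Lemma complex_sumE (R : realType) (I : Type) (s : seq I) (f : I -> R[i]) :
  \sum_(u <- s) f u = Complex (\sum_(u <- s) complex.Re (f u)) (\sum_(u <- s) complex.Im (f u)).
Proof.
elim: s => [|u s IH]; first by rewrite !big_nil.
by rewrite !big_cons IH; case: (f u) => x y.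
Qed.

(** The unimodular z = x + iy supplied by the Toeplitz theorem are the points sought. The real and
    imaginary parts of z^k, k <= 4, span the polynomials of degree at most 4 on the circle, so the
    trigonometric moments determine those listed. *)
Lemma circle_measure (R : realType) (beta : word -> R) (a b c d e : R) :
  psd (Lmx beta a b c d e) ->
  exists s : seq (R * (R * R)),
    [/\ forall u, u \in s -> 0 < u.1, forall u, u \in s -> u.2.1 ^+ 2 + u.2.2 ^+ 2 = 1 &
    [/\ forall v, v \in [:: [:: lX]; [:: lY]; [:: lX; lX; lX]; [:: lX; lX; lY]] ->
          beta v = \sum_(u <- s) u.1 * point_moment u.2 v,
        a = \sum_(u <- s) u.1,
        b = \sum_(u <- s) u.1 * u.2.1 ^+ 2 /\ c = \sum_(u <- s) u.1 * (u.2.1 * u.2.2) &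
        d = \sum_(u <- s) u.1 * u.2.1 ^+ 4 /\
        e = \sum_(u <- s) u.1 * (u.2.1 ^+ 3 * u.2.2)]].
Proof.
move=> L0.
pose T := (circle_coef R) ^t* *m map_mx (real_complex R) (Lmx beta a b c d e) *m circle_coef R.
have TE := circle_toeplitz beta a b c d e; rewrite -/T in TE.
have hT : hpsd T.
  have [hL L1] := hpsd_real L0; split.
    by rewrite /T !trmxC_mul hL trmxCK mulmxA.
  by move=> x; have := L1 (circle_coef R *m x); rewrite /hform trmxC_mul !mulmxA.
have tT : toeplitz T.
  by move=> i j i' j' ei ej; rewrite !TE ei ej ltnS !subSS.
have [s [s0 sT]] := toeplitz_psd_measure hT tT.
pose s' := [seq (complex.Re u.1, (complex.Re u.2, complex.Im u.2)) | u <- s].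
have s'P u : u \in s' -> 0 < u.1 /\ u.2.1 ^+ 2 + u.2.2 ^+ 2 = 1.
  move=> /mapP[[w z] /s0[/= w0 z1] ->] /=; split; first by move: w0; rewrite ltcE => /andP[].
  move/(congr1 (@complex.Re R)): z1; rewrite /Num.conj; case: z => x y /= <-; ring.
have mom k : (k < 5)%N -> trig_moment beta a b c d e k =
    Complex (\sum_(u <- s') u.1 * complex.Re (Complex u.2.1 u.2.2 ^+ k))
            (\sum_(u <- s') u.1 * complex.Im (Complex u.2.1 u.2.2 ^+ k)).
  move=> k5; have := TE ord0 (Ordinal k5); rewrite sT /= subn0 => <-.
  rewrite complex_sumE !big_map; congr Complex; apply: eq_big_seq => u /s0[];
  rewrite ltcE => /andP[/= /eqP w0 _] _; rewrite expr0 conjC1 mul1r.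
    by case: u w0 => [[x y] [x' y']] /= ->; case: (_ ^+ k) => p q /=; ring.
  by case: u w0 => [[x y] [x' y']] /= ->; case: (_ ^+ k) => p q /=; ring.
exists s'; split=> [u /s'P[]//|u /s'P[]//|].
pose ell (f : R -> R -> R) := \sum_(u <- s') u.1 * f u.2.1 u.2.2.
(* One triangular step: a multiple-angle formula expresses part of z^n by a new monomial f and by g,
   h of lower degree, whose moments are already known; p is the leading coefficient. *)
have eRe n (p q r v : R) (f g h : R -> R -> R) : (n < 5)%N -> p != 0 ->
    complex.Re (trig_moment beta a b c d e n) = p * v + q * ell g + r * ell h ->
    (forall x y, x ^+ 2 + y ^+ 2 = 1 ->
       complex.Re (Complex x y ^+ n) = p * f x y + q * g x y + r * h x y) ->
    v = ell f.
  move=> n5 p0 vE nE; apply: (mulfI p0); apply: (addIr (q * ell g)).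
  apply: (addIr (r * ell h)); rewrite -vE mom //= /ell !mulr_sumr -!big_split.
  by apply: eq_big_seq => u /s'P[_ h1] /=; rewrite nE //; ring.
have eIm n (p q r v : R) (f g h : R -> R -> R) : (n < 5)%N -> p != 0 ->
    complex.Im (trig_moment beta a b c d e n) = p * v + q * ell g + r * ell h ->
    (forall x y, x ^+ 2 + y ^+ 2 = 1 ->
       complex.Im (Complex x y ^+ n) = p * f x y + q * g x y + r * h x y) ->
    v = ell f.
  move=> n5 p0 vE nE; apply: (mulfI p0); apply: (addIr (q * ell g)).
  apply: (addIr (r * ell h)); rewrite -vE mom //= /ell !mulr_sumr -!big_split.
  by apply: eq_big_seq => u /s'P[_ h1] /=; rewrite nE //; ring.
pose one (_ _ : R) : R := 1.
have e0 : a = ell one.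
  apply: (@eRe 0 1 0 0 _ _ one one) => //; first by rewrite ?oner_eq0 ?pnatr_eq0.
    by rewrite /trig_moment /=; ring.
  by move=> x y h; rewrite /one /=; apply: (lincomb (k := 0) h); ring.
have eX : beta [:: lX] = ell (fun x _ => x).
  apply: (@eRe 1 1 0 0 _ _ one one) => //; first by rewrite ?oner_eq0 ?pnatr_eq0.
    by rewrite /trig_moment /=; ring.
  by move=> x y h; rewrite /one /=; apply: (lincomb (k := 0) h); ring.
have eY : beta [:: lY] = ell (fun _ y => y).
  apply: (@eIm 1 1 0 0 _ _ one one) => //; first by rewrite ?oner_eq0 ?pnatr_eq0.
    by rewrite /trig_moment /=; ring.
  by move=> x y h; rewrite /one /=; apply: (lincomb (k := 0) h); ring.
have eb : b = ell (fun x _ => x ^+ 2).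
  apply: (@eRe 2 2 (-1) 0 _ _ one one) => //; first by rewrite ?oner_eq0 ?pnatr_eq0.
    by rewrite -e0 /trig_moment /=; ring.
  by move=> x y h; rewrite /one /=; apply: (lincomb (k := - 1) h); ring.
have ec : c = ell (fun x y => x * y).
  apply: (@eIm 2 2 0 0 _ _ one one) => //; first by rewrite ?oner_eq0 ?pnatr_eq0.
    by rewrite /trig_moment /=; ring.
  by move=> x y h; rewrite /one /=; apply: (lincomb (k := 0) h); ring.
have exxx : beta [:: lX; lX; lX] = ell (fun x _ => x ^+ 3).
  apply: (@eRe 3 4 (-3) 0 _ _ (fun x _ => x) one) => //; first by rewrite ?oner_eq0 ?pnatr_eq0.
    by rewrite -eX /trig_moment /=; ring.
  by move=> x y h; rewrite /one /=; apply: (lincomb (k := - 3 * x) h); ring.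
have exxy : beta [:: lX; lX; lY] = ell (fun x y => x ^+ 2 * y).
  apply: (@eIm 3 4 (-1) 0 _ _ (fun _ y => y) one) => //; first by rewrite ?oner_eq0 ?pnatr_eq0.
    by rewrite -eY /trig_moment /=; ring.
  by move=> x y h; rewrite /one /=; apply: (lincomb (k := - y) h); ring.
have ed : d = ell (fun x _ => x ^+ 4).
  apply: (@eRe 4 8 (-8) 1 _ _ (fun x _ => x ^+ 2) one) => //; first by rewrite ?oner_eq0 ?pnatr_eq0.
    by rewrite -eb -e0 /trig_moment /=; ring.
  by move=> x y h; rewrite /one /=; apply: (lincomb (k := y ^+ 2 + 1 - x ^+ 2 *+ 7) h); ring.
have ee : e = ell (fun x y => x ^+ 3 * y).
  apply: (@eIm 4 8 (-4) 0 _ _ (fun x y => x * y) one) => //; first by rewrite ?oner_eq0 ?pnatr_eq0.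
    by rewrite -ec /trig_moment /=; ring.
  by move=> x y h; rewrite /one /=; apply: (lincomb (k := - (4 * x * y)) h); ring.
split=> //.
  move=> v; rewrite !inE => /or4P[] /eqP ->;
    rewrite ?eX ?eY ?exxx ?exxy; apply: eq_bigr => u _; rewrite /point_moment /=; ring.
by rewrite e0; apply: eq_bigr => u _; rewrite mulr1.
Qed.

(** * Words modulo the circle relation *)

(** The relation is imposed at the head of a word only; cyclic invariance carries it to any other
    place. *)
Definition circle_sequence (R : realType) (F : word -> R) : Prop :=
  moment_sequence F /\
  forall w : word, (size w <= 2)%N -> F [:: lY, lY & w] = F w - F [:: lX, lX & w].

(* Reduces a word of length at most 4 modulo cyclic equivalence and y^2 = 1 - x^2; only
   XYXY needs a monomial outside x^i and x^i y. *)
Definition circle_value (R : realType) (F : word -> R) (w : word) : R :=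
  let x := count_mem lX w in
  match count_mem lY w with
  | 0 => F (nseq x lX)
  | 1 => F (rcons (nseq x lX) lY)
  | 2 => if w \in [:: [:: lX; lY; lX; lY]; [:: lY; lX; lY; lX]]
         then F [:: lX; lY; lX; lY] else F (nseq x lX) - F (nseq x.+2 lX)
  | 3 => F (rcons (nseq x lX) lY) - F (rcons (nseq x.+2 lX) lY)
  | _ => F [::] - F [:: lX; lX] *+ 2 + F [:: lX; lX; lX; lX]
  end.

Lemma circle_valueE (R : realType) (F : word -> R) w :
  circle_sequence F -> (size w <= 4)%N -> F w = circle_value F w.
Proof.
move=> [hF hY].
have H k v : (size v <= 4)%N -> F v = F (rot k v) by move=> /hF[->].
have Y2 k u v : (size u <= 2)%N -> (size v <= 4)%N -> rot k v = [:: lY, lY & u] ->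
    F v = F u - F [:: lX, lX & u].
  by move=> su sv e; rewrite (H k) // e hY.
rewrite /circle_value.
case: w => [|[] [|[] [|[] [|[] [|? ?]]]]] //= _; rewrite /=;
  first [exact: (H 1%N) | exact: (H 2%N) | exact: (H 3%N)
        | exact: (Y2 0%N) | exact: (Y2 1%N) | exact: (Y2 2%N) | exact: (Y2 3%N) | idtac].
(* The word left is YYYY, where the relation is applied to both YY and XXYY after the first
   reduction. *)
rewrite hY // hY // (Y2 2%N [:: lX; lX] [:: lX; lX; lY; lY]) //; ring.
Qed.

Lemma eq_circle_sequence (R : realType) (F G : word -> R) :
  circle_sequence F -> circle_sequence G ->
  (forall w, w \in [:: [::]; [:: lX]; [:: lY]; [:: lX; lX]; [:: lX; lY];
     [:: lX; lX; lX]; [:: lX; lX; lY]; [:: lX; lX; lX; lX]; [:: lX; lX; lX; lY];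
     [:: lX; lY; lX; lY]] -> F w = G w) ->
  forall w, (size w <= 4)%N -> F w = G w.
Proof.
move=> hF hG FG w sw; rewrite (circle_valueE hF sw) (circle_valueE hG sw) /circle_value.
by move: sw; case: w => [|[] [|[] [|[] [|[] [|? ?]]]]] //= _; rewrite /= !FG.
Qed.

Lemma circle_sequence_sum (R : realType) (I : eqType) (s : seq I) (c : I -> R)
    (F : I -> word -> R) :
  (forall u, u \in s -> circle_sequence (F u)) ->
  circle_sequence (fun w => \sum_(u <- s) c u * F u w).
Proof.
move=> hF; split=> w sw.
  by split=> [k|]; apply: eq_big_seq => u /hF[/(_ w sw)[h1 h2] _]; rewrite ?h1 ?h2.
by rewrite -sumrB; apply: eq_big_seq => u /hF[_ ->] //; rewrite mulrBr.
Qed.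

(** The column relation, read in the row indexed by the reverse of w, is the circle relation at the
    tail of w; a rotation moves it to the head. *)
Lemma M2_circle (R : realType) (beta : word -> R) :
  moment_sequence beta ->
  wcol (M2 beta) [:: lY; lY] = wcol (M2 beta) [::] - wcol (M2 beta) [:: lX; lX] ->
  circle_sequence beta.
Proof.
move=> hb hrel; split=> // w sw.
have wB : rev w \in basis by case: w sw => [|[] [|[] [|? ?]]].
move/matrixP: hrel => /(_ (idx (rev w)) 0).
rewrite !mxE /idx !inordK ?index_mem // nth_index // revK /= cats0 => h.
have rotE (u : word) : size u = 2%N -> beta (u ++ w) = beta (w ++ u).
  move=> su; have sz : (size (w ++ u) <= 4)%N by rewrite size_cat su; case: (size w) sw => [|[|[]]].
  by have [/(_ (size w)) <- _] := hb _ sz; rewrite rot_size_cat.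
by rewrite (rotE [:: lY; lY]) // h -(rotE [:: lX; lX]).
Qed.

(** The extra hypothesis identifies XYXY with X^2Y^2, since the latter reduces to X^2 - X^4; it is
    the only trace of commutativity visible in degree 4. *)
Lemma Lmx_circle_sequence (R : realType) (F : word -> R) :
  circle_sequence F -> F [:: lX; lY; lX; lY] = F [:: lX; lX] - F [:: lX; lX; lX; lX] ->
  M2 F = Lmx F (F [::]) (F [:: lX; lX]) (F [:: lX; lY]) (F [:: lX; lX; lX; lX])
    (F [:: lX; lX; lX; lY]).
Proof.
move=> hF hXY; apply/matrixP => i j; rewrite !mxE.
case: i => [[|[|[|[|[|[|[|//]]]]]]] li]; case: j => [[|[|[|[|[|[|[|//]]]]]]] lj];
by rewrite [LHS](circle_valueE hF) // /circle_value /= ?hXY; ring.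
Qed.

(** * The commutative part of a measure *)

Lemma wmx_cat (R : realType) t (A B : 'M[R]_t) u v :
  wmx A B (u ++ v) = wmx A B u *m wmx A B v.
Proof. by elim: u => [|l u IH] /=; rewrite ?mul1mx // IH mulmxA. Qed.

Lemma wmx_rev (R : realType) t (A B : 'M[R]_t) w :
  A^T = A -> B^T = B -> wmx A B (rev w) = (wmx A B w)^T.
Proof.
move=> hA hB; elim: w => [|l w IH] /=; first by rewrite trmx1.
by rewrite rev_cons -cats1 wmx_cat IH /= mulmx1 trmx_mul; case: l; rewrite /= ?hA ?hB.
Qed.

Lemma wmx_comm (R : realType) t (A B P : 'M[R]_t) w :
  A *m P = P *m A -> B *m P = P *m B -> wmx A B w *m P = P *m wmx A B w.
Proof.
move=> hA hB; elim: w => [|l w IH] /=; first by rewrite mul1mx mulmx1.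
by rewrite -mulmxA IH !mulmxA; case: l; rewrite /= ?hA ?hB.
Qed.

Definition trace_moment (R : realType) t (A B P : 'M[R]_t) (w : word) : R :=
  \tr (wmx A B w *m P).

Lemma trace_circle_sequence (R : realType) t (A B P : 'M[R]_t) :
  A^T = A -> B^T = B -> P^T = P -> A *m P = P *m A -> B *m P = P *m B ->
  A *m A + B *m B = 1%:M -> circle_sequence (trace_moment A B P).
Proof.
move=> hA hB hP AP BP AB; split=> w _; last first.
  rewrite /trace_moment /= -linearB -mulmxBl /=; congr (\tr (_ *m _)).
  by rewrite !mulmxA -{2}[wmx A B w]mul1mx -AB mulmxDl addrC addKr.
split=> [k|].
  rewrite /trace_moment /rot wmx_cat -[in RHS](cat_take_drop k w) wmx_cat.
  by rewrite -mulmxA mxtrace_mulC -!mulmxA (wmx_comm (drop k w) AP).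
by rewrite /trace_moment wmx_rev // -mxtrace_tr trmx_mul trmxK hP -wmx_comm.
Qed.

Lemma mxtrace_trmx_mul_ge0 (R : realType) m n (M : 'M[R]_(m, n)) : 0 <= \tr (M^T *m M).
Proof.
apply: sumr_ge0 => i _; rewrite mxE; apply: sumr_ge0 => j _.
by rewrite mxE -expr2 sqr_ge0.
Qed.

Lemma mxtrace_trmx_mul_eq0 (R : realType) m n (M : 'M[R]_(m, n)) :
  \tr (M^T *m M) = 0 -> M = 0.
Proof.
move=> /eqP; rewrite psumr_eq0 => [|i _]; last first.
  by rewrite mxE; apply: sumr_ge0 => j _; rewrite mxE -expr2 sqr_ge0.
move=> /allP h; apply/matrixP => i j; rewrite [RHS]mxE.
have := h j (mem_index_enum _); rewrite mxE psumr_eq0 => [|k _]; last first.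
  by rewrite mxE -expr2 sqr_ge0.
by move=> /allP /(_ i (mem_index_enum _)); rewrite mxE -expr2 sqrf_eq0 => /eqP.
Qed.

Lemma size_M2_word (i j : 'I_7) :
  (size (rev (nth [::] basis i) ++ nth [::] basis j) <= 4)%N.
Proof.
have sB (k : 'I_7) : (size (nth [::] basis k) <= 2)%N.
  by case: k => [[|[|[|[|[|[|[|//]]]]]]] lk].
by rewrite size_cat size_rev; apply: (@leq_add _ _ 2 2); exact: sB.
Qed.

Lemma M2_sym (R : realType) (F : word -> R) : moment_sequence F -> (M2 F)^T = M2 F.
Proof.
move=> hF; apply/matrixP => i j; rewrite !mxE.
by have [_ <-] := hF _ (size_M2_word j i); rewrite rev_cat revK.
Qed.

Lemma quadE (R : comPzRingType) n (M : 'M[R]_n) (v : 'cV[R]_n) :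
  (v^T *m M *m v) 0 0 = \sum_i \sum_j v i 0 * v j 0 * M i j.
Proof.
rewrite mxE exchange_big; apply: eq_bigr => j _; rewrite !mxE mulr_suml.
by apply: eq_bigr => i _; rewrite !mxE mulrAC.
Qed.

Lemma M2_quad (R : realType) (F : word -> R) (v : 'cV[R]_7) :
  (v^T *m M2 F *m v) 0 0 =
  \sum_i \sum_j v i 0 * v j 0 * F (rev (nth [::] basis i) ++ nth [::] basis j).
Proof. by rewrite quadE; do 2 apply: eq_bigr => ? _; rewrite mxE. Qed.

(** The form of the moment matrix is a squared Frobenius norm: Z is the noncommutative polynomial
    with coefficients v evaluated at the pair, compressed by the projection P. *)
Lemma trace_moment_quad (R : realType) t (A B P : 'M[R]_t) (v : 'cV[R]_7) :
  A^T = A -> B^T = B -> P^T = P -> A *m P = P *m A -> B *m P = P *m B -> P *m P = P ->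
  (v^T *m M2 (trace_moment A B P) *m v) 0 0 =
  let Z := \sum_i v i 0 *: wmx A B (nth [::] basis i) in \tr ((Z *m P)^T *m (Z *m P)).
Proof.
move=> hA hB hP AP BP PP; rewrite M2_quad /=.
pose Z : 'M[R]_t := \sum_i v i 0 *: wmx A B (nth [::] basis i); rewrite -/Z.
have -> : \tr ((Z *m P)^T *m (Z *m P)) = \tr (Z^T *m Z *m P).
  rewrite trmx_mul hP -mulmxA [LHS]mxtrace_mulC -!mulmxA (mulmxA P P) PP.
  by rewrite (mulmxA Z) [LHS]mxtrace_mulC !mulmxA.
have -> : Z^T = \sum_i v i 0 *: (wmx A B (nth [::] basis i))^T.
  by rewrite linear_sum; apply: eq_bigr => i _; rewrite linearZ.
rewrite !mulmx_suml linear_sum; apply: eq_bigr => i _ /=.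
rewrite /Z mulmx_sumr mulmx_suml linear_sum; apply: eq_bigr => j _ /=.
rewrite /trace_moment wmx_cat wmx_rev // -!scalemxAl -!scalemxAr -!scalemxAl.
by rewrite !linearZ /= mulrA.
Qed.

Lemma psd_M2_sum (R : realType) (I : eqType) (s : seq I) (c : I -> R) (F : I -> word -> R) :
  (forall u, u \in s -> [/\ 0 <= c u, moment_sequence (F u) &
     forall v : 'cV[R]_7, 0 <= (v^T *m M2 (F u) *m v) 0 0]) ->
  psd (M2 (fun w => \sum_(u <- s) c u * F u w)).
Proof.
move=> hs; split=> [|v].
  apply: M2_sym => w sw; split=> [k|]; apply: eq_big_seq => u /hs[_ /(_ w sw)[h1 h2] _].
    by rewrite h1.
  by rewrite h2.
suff -> : (v^T *m M2 (fun w => \sum_(u <- s) c u * F u w) *m v) 0 0 =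
    \sum_(u <- s) c u * (v^T *m M2 (F u) *m v) 0 0.
  rewrite big_seq; apply: sumr_ge0 => u /hs[c0 _ F0]; exact: mulr_ge0.
rewrite M2_quad; under [RHS]eq_bigr do rewrite M2_quad mulr_sumr.
rewrite [RHS]exchange_big; apply: eq_bigr => i _.
under [RHS]eq_bigr do rewrite mulr_sumr.
rewrite [RHS]exchange_big; apply: eq_bigr => j _.
by rewrite mulr_sumr; apply: eq_bigr => u _; rewrite mulrCA.
Qed.

(** If N K K^T = 0 then the Frobenius norm of N K is 0, so N K = 0, and N = 0 by row freeness. *)
Lemma gram_unitmx (R : realType) m n (K : 'M[R]_(m, n)) : row_free K -> K *m K^T \in unitmx.
Proof.
move=> hK; rewrite -row_free_unit -kermx_eq0; set N := kermx _.
rewrite -(mulmx_free_eq0 _ hK); apply/eqP/trmx_inj; rewrite trmx0.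
apply: mxtrace_trmx_mul_eq0.
by rewrite trmxK trmx_mul -mulmxA (mulmxA K) mulmxA mulmx_ker mul0mx linear0.
Qed.

(* On the range of the commutator C, where C is invertible and anticommutes with odd words w,
   tr w = tr (w C C^-1) = - tr (C w C^-1) = - tr w. *)
Lemma commutator_projection (R : realType) t (A B : 'M[R]_t) :
  A^T = A -> B^T = B -> A *m A + B *m B = 1%:M ->
  exists P : 'M[R]_t, [/\ P^T = P, P *m P = P, A *m P = P *m A /\ B *m P = P *m B,
    A *m B *m P = B *m A *m P &
    forall w, odd (size w) -> \tr (wmx A B w *m (1%:M - P)) = 0].
Proof.
move=> hA hB AB.
set C := A *m B - B *m A.
have B2 : B *m B = 1%:M - A *m A by rewrite -AB addrC addKr.
have A2 : A *m A = 1%:M - B *m B by rewrite -AB addrK.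
have AC : A *m C = - (C *m A).
  rewrite /C mulmxBr mulmxBl opprB -!mulmxA; congr (_ - _).
  rewrite (mulmxA A A B) A2 (mulmxBl 1%:M) mulmxBr mul1mx mulmx1.
  by rewrite !mulmxA.
have BC : B *m C = - (C *m B).
  rewrite /C mulmxBr mulmxBl opprB -!mulmxA; congr (_ - _).
  rewrite (mulmxA B B A) B2 (mulmxBl 1%:M) mulmxBr mul1mx mulmx1.
  by rewrite !mulmxA.
have CT : C^T = - C by rewrite /C linearB /= !trmx_mul hA hB opprB.
have [k [K [Kfree KC inK]]] : exists k (K : 'M[R]_(k, t)), [/\ row_free K, K *m C = 0 &
    forall m (M : 'M[R]_(m, t)), M *m C = 0 -> (M <= K)%MS].
  exists (\rank (kermx C)), (row_base (kermx C)); split; first exact: row_base_free.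
    by apply/sub_kermxP; rewrite eq_row_base.
  by move=> m M MC; rewrite eq_row_base; apply/sub_kermxP.
have KKu : K *m K^T \in unitmx by exact: gram_unitmx.
(* The orthogonal projection onto the row space of K, that is onto ker C; as C is antisymmetric, its
   left and right kernels are transposes of each other. *)
set P := K^T *m invmx (K *m K^T) *m K.
have PT : P^T = P.
  by rewrite /P !trmx_mul trmxK trmx_inv trmx_mul trmxK mulmxA.
have KP m (M : 'M[R]_(m, t)) : (M <= K)%MS -> M *m P = M.
  by move=> /submxP[D ->]; rewrite /P !mulmxA -(mulmxA D K) mulmxK.
have PK m (M : 'M[R]_(m, t)) : (M *m P <= K)%MS by rewrite /P !mulmxA submxMl.
have PP : P *m P = P by rewrite KP // -[P]mul1mx PK.
have PC : P *m C = 0 by rewrite /P -mulmxA KC mulmx0.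
clearbody P.
have CP : C *m P = 0.
  by apply/trmx_inj; rewrite trmx_mul PT CT mulmxN PC oppr0 trmx0.
(* Anticommuting with C, M preserves ker C; being symmetric it preserves the orthogonal complement
   too. *)
have comm M : M^T = M -> M *m C = - (C *m M) -> M *m P = P *m M.
  move=> hM MC.
  have PMP : P *m M *m P = P *m M.
    by apply: KP; apply: inK; rewrite -mulmxA MC mulmxN mulmxA PC mul0mx oppr0.
  have := congr1 trmx PMP; rewrite !trmx_mul PT hM => <-.
  by rewrite -PMP mulmxA.
have AP := comm A hA AC; have BP := comm B hB BC.
exists P; split=> //.
  by apply/eqP; rewrite -subr_eq0 -mulmxBl -/C CP.
set Q := 1%:M - P.
have [E QE] : exists E, Q = E *m C.
  apply/submxP; rewrite submxE; set N := cokermx C.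
  suff PN : P *m N = N by rewrite /Q mulmxBl mul1mx PN subrr.
  apply/trmx_inj; rewrite trmx_mul PT; apply: KP; apply: inK.
  by apply/trmx_inj; rewrite trmx_mul trmxK CT mulNmx mulmx_coker oppr0 trmx0.
have QT : Q^T = Q by rewrite /Q linearB /= trmx1 PT.
have CQ : C *m Q = C by rewrite /Q mulmxBr mulmx1 CP subr0.
(* F plays the part of the inverse of C on the range of Q: C F = Q, and below Q F C = Q. *)
pose F := - E^T.
have QF : Q = C *m F by rewrite -QT QE trmx_mul CT mulNmx mulmxN.
have QC : Q *m C = C by rewrite /Q mulmxBl mul1mx PC subr0.
have FC : Q *m F *m C = Q by rewrite [in Q *m F]QE -(mulmxA E) -QF -mulmxA QC -QE.
have wC w : wmx A B w *m C = (-1) ^+ size w *: (C *m wmx A B w).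
  elim: w => [|l w IH] /=; first by rewrite mul1mx mulmx1 scale1r.
  rewrite -mulmxA IH -scalemxAr !mulmxA exprS -scalerA scaleN1r.
  by case: l => /=; rewrite ?AC ?BC mulNmx scalerN.
move=> w ow; have wQ : wmx A B w *m Q = Q *m wmx A B w.
  by apply: wmx_comm; rewrite /Q mulmxBr mulmxBl mulmx1 mul1mx ?AP ?BP.
have wCN : wmx A B w *m C = - (C *m wmx A B w).
  by rewrite wC -signr_odd ow expr1 scaleN1r.
have h1 : \tr (wmx A B w *m Q) = - \tr (wmx A B w *m F *m C).
  by rewrite {1}QF mulmxA wCN mulNmx raddfN /= -(mulmxA C) mxtrace_mulC.
have h2 : \tr (wmx A B w *m F *m C) = \tr (wmx A B w *m Q).
  rewrite -{1}CQ mulmxA mxtrace_mulC !mulmxA -wQ -(mulmxA _ Q) -(mulmxA _ _ C).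
  by rewrite FC.
by move: h1; rewrite h2; lra.
Qed.

Lemma M2Z (R : realType) (k : R) (F : word -> R) : M2 (fun w => k * F w) = k *: M2 F.
Proof. by apply/matrixP => i j; rewrite !mxE. Qed.

Lemma atom_split (R : realType) t (A B : 'M[R]_t) :
  A^T = A -> B^T = B -> A *m A + B *m B = 1%:M ->
  exists f : word -> R, [/\ circle_sequence f,
    forall v : 'cV[R]_7, 0 <= (v^T *m M2 f *m v) 0 0,
    circle_sequence (fun w => ntr (wmx A B w) - f w) /\
    forall v : 'cV[R]_7, 0 <= (v^T *m M2 (fun w => ntr (wmx A B w) - f w) *m v) 0 0,
    forall w, odd (size w) -> f w = ntr (wmx A B w) &
    f [:: lX; lY; lX; lY] = f [:: lX; lX] - f [:: lX; lX; lX; lX]].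
Proof.
move=> hA hB AB.
have [P [PT PP [AP BP] ABP Podd]] := commutator_projection hA hB AB.
pose k : R := t%:R^-1.
have k0 : 0 <= k by rewrite invr_ge0 ler0n.
have QE : (fun w => ntr (wmx A B w) - k * trace_moment A B P w) =
    (fun w => k * trace_moment A B (1%:M - P) w).
  apply: funext => w; rewrite /ntr /trace_moment mulmxBr mulmx1 linearB /=.
  by rewrite -/k mulrBr [_ * k]mulrC.
have QT : (1%:M - P)^T = 1%:M - P by rewrite linearB /= trmx1 PT.
have QQ : (1%:M - P) *m (1%:M - P) = 1%:M - P.
  by rewrite mulmxBr mulmx1 mulmxBl mul1mx PP subrr subr0.
have AQ : A *m (1%:M - P) = (1%:M - P) *m A by rewrite mulmxBr mulmxBl mul1mx mulmx1 AP.
have BQ : B *m (1%:M - P) = (1%:M - P) *m B by rewrite mulmxBr mulmxBl mul1mx mulmx1 BP.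
have cZ (S : 'M[R]_t) : circle_sequence (trace_moment A B S) ->
    circle_sequence (fun w => k * trace_moment A B S w).
  move=> [h1 h2]; split=> w sw; last by rewrite h2 // mulrBr.
  by have [h3 h4] := h1 w sw; split=> [m|]; rewrite ?h3 ?h4.
have qZ (S : 'M[R]_t) (v : 'cV[R]_7) : S^T = S -> A *m S = S *m A -> B *m S = S *m B ->
    S *m S = S -> 0 <= (v^T *m M2 (fun w => k * trace_moment A B S w) *m v) 0 0.
  move=> h1 h2 h3 h4; rewrite M2Z -scalemxAr -scalemxAl mxE mulr_ge0 //.
  by rewrite trace_moment_quad //= mxtrace_trmx_mul_ge0.
exists (fun w => k * trace_moment A B P w); rewrite QE; split.
- by apply: cZ; exact: trace_circle_sequence.
- by move=> v; exact: qZ.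
- by split=> [|v]; [apply: cZ; exact: trace_circle_sequence | exact: qZ].
- move=> w /Podd; rewrite mulmxBr mulmx1 linearB /= => /eqP.
  by rewrite subr_eq0 => /eqP h; rewrite /ntr h mulrC.
(* On the range of P the matrices commute, so ABAB becomes A^2 B^2 = A^2 (1 - A^2) there. *)
- rewrite -mulrBr /trace_moment -linearB -mulmxBl /= !mulmx1.
  congr (_ * \tr _); rewrite -!mulmxA (mulmxA A B P) ABP.
  rewrite -(mulmxA B A P) (mulmxA B B) (_ : B *m B = 1%:M - A *m A); last first.
    by rewrite -AB addrC addKr.
  by rewrite !(mulmxBl, mulmxBr) mul1mx !mulmxA.
Qed.

Lemma atom_circle_defect (R : realType) t (A B : 'M[R]_t) (F := trace_moment A B 1%:M) :
  A^T = A -> B^T = B ->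
  F [::] - (F [:: lX; lX] + F [:: lY; lY]) *+ 2 + F [:: lX; lX; lX; lX]
    + F [:: lX; lX; lY; lY] *+ 2 + F [:: lY; lY; lY; lY]
  = \tr ((1%:M - A *m A - B *m B)^T *m (1%:M - A *m A - B *m B)).
Proof.
move=> hA hB.
have -> : (1%:M - A *m A - B *m B)^T = 1%:M - A *m A - B *m B.
  by rewrite !linearB /= trmx1 !trmx_mul hA hB.
rewrite !(mulmxBr, mulmxBl) !(mulmx1, mul1mx) !mulmxA !linearB /=.
rewrite /F /trace_moment /= !mulmx1 !mulmxA.
have -> : \tr (B *m B *m A *m A) = \tr (A *m A *m B *m B).
  by rewrite -mulmxA mxtrace_mulC !mulmxA.
ring.
Qed.

(** The functional D vanishes on circle sequences, while on a measure it is a positive combination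
    of squared Frobenius norms of 1 - A^2 - B^2; hence each of them vanishes. *)
Lemma represents_circle (R : realType) (mu : seq (atom R)) (beta : word -> R) :
  circle_sequence beta -> represents mu beta ->
  forall i : 'I_(size mu), let u := tnth (in_tuple mu) i in
    aX u *m aX u + aY u *m aY u = 1%:M.
Proof.
move=> hb [wf _ rep].
pose D (F : word -> R) := F [::] - (F [:: lX; lX] + F [:: lY; lY]) *+ 2 +
  F [:: lX; lX; lX; lX] + F [:: lX; lX; lY; lY] *+ 2 + F [:: lY; lY; lY; lY].
have D0 : D beta = 0.
  by rewrite /D !(circle_valueE hb) // /circle_value /=; ring.
have Dlin (J : Type) (s : seq J) (c : J -> R) (G : J -> word -> R) :
    D (fun w => \sum_(j <- s) c j * G j w) = \sum_(j <- s) c j * D (G j).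
  elim: s => [|j s IH]; first by rewrite /D !big_nil; ring.
  by rewrite big_cons -IH /D !big_cons; ring.
pose u i := tnth (in_tuple mu) i.
pose S i := 1%:M - aX (u i) *m aX (u i) - aY (u i) *m aY (u i).
have DE : D beta =
    \sum_(i < size mu) aweight (u i) * (\tr ((S i)^T *m S i) / (asize (u i))%:R).
  have -> : D beta =
      D (fun w => \sum_(i < size mu) aweight (u i) * ntr (wmx (aX (u i)) (aY (u i)) w)).
    have repE w : (size w <= 4)%N -> beta w =
        \sum_(i < size mu) aweight (u i) * ntr (wmx (aX (u i)) (aY (u i)) w).
      by move=> sw; rewrite rep // big_tnth.
    by rewrite /D !repE.
  rewrite Dlin; apply: eq_bigr => i _; case: (wf i) => _ _ hA hB; congr (_ * _).
  rewrite /S -atom_circle_defect // /trace_moment !mulmx1 /D /ntr.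
  by set k := _^-1; ring.
move=> i /=; case: (wf i) => t0 w0 _ _.
move: D0; rewrite DE => /eqP; rewrite psumr_eq0 => [|j _]; last first.
  case: (wf j) => _ w0' _ _.
  apply: mulr_ge0; first exact: ltW.
  by apply: divr_ge0; [exact: mxtrace_trmx_mul_ge0 | exact: ler0n].
move=> /allP /(_ i (mem_index_enum _)) /=.
rewrite !mulf_eq0 invr_eq0 pnatr_eq0 (gtn_eqF t0) (gt_eqF w0) orbF /= => /eqP.
by move=> /mxtrace_trmx_mul_eq0 /eqP; rewrite /S -addrA -opprD subr_eq0 eq_sym => /eqP.
Qed.

Lemma represents_split (R : realType) (mu : seq (atom R)) (beta : word -> R) :
  circle_sequence beta -> represents mu beta ->
  exists a b c d e, psd (Lmx beta a b c d e) /\ psd (M2 beta - Lmx beta a b c d e).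
Proof.
move=> hb hmu; have AB := represents_circle hb hmu; have [wf _ rep] := hmu.
pose u i := tnth (in_tuple mu) i.
have /boolp.choice[f hf] : forall i, exists f : word -> R, [/\ circle_sequence f,
    forall v : 'cV[R]_7, 0 <= (v^T *m M2 f *m v) 0 0,
    circle_sequence (fun w => ntr (wmx (aX (u i)) (aY (u i)) w) - f w) /\
    forall v : 'cV[R]_7,
      0 <= (v^T *m M2 (fun w => ntr (wmx (aX (u i)) (aY (u i)) w) - f w) *m v) 0 0,
    forall w, odd (size w) -> f w = ntr (wmx (aX (u i)) (aY (u i)) w) &
    f [:: lX; lY; lX; lY] = f [:: lX; lX] - f [:: lX; lX; lX; lX]].
  by move=> i; case: (wf i) => _ _ hA hB; exact: atom_split (AB i).
pose la i := aweight (u i).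
have la0 i : 0 <= la i by apply: ltW; case: (wf i).
pose F w := \sum_(i < size mu) la i * f i w.
have hF : circle_sequence F.
  by apply: circle_sequence_sum => i _; case: (hf i).
have Fodd w : odd (size w) -> (size w <= 4)%N -> beta w = F w.
  move=> ow sw; rewrite rep // big_tnth; apply: eq_bigr => i _.
  by have [_ _ _ h _] := hf i; rewrite (h w).
(* [Lmx] reads only odd moments of the sequence, and these agree for [beta] and the commutative part
   F. *)
have -> : @Lmx R beta = Lmx F.
  do 5! (apply: funext => ?); by apply: eq_Lmx; exact: Fodd.
exists (F [::]), (F [:: lX; lX]), (F [:: lX; lY]), (F [:: lX; lX; lX; lX]), (F [:: lX; lX; lX; lY]).
rewrite -Lmx_circle_sequence //; last first.
  by rewrite /F -sumrB; apply: eq_bigr => i _; case: (hf i) => _ _ _ _ ->; rewrite mulrBr.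
split.
  by apply: psd_M2_sum => i _; case: (hf i) => -[h1 _] h2 _ _ _; split.
have -> : M2 beta - M2 F = M2 (fun w => \sum_(i < size mu)
    la i * (ntr (wmx (aX (u i)) (aY (u i)) w) - f i w)).
  apply/matrixP => i j; rewrite !mxE.
  rewrite (rep _ (size_M2_word i j)).
  by rewrite big_tnth -sumrB; apply: eq_bigr => k _; rewrite -mulrBr.
by apply: psd_M2_sum => i _; case: (hf i) => _ _ [[h1 _] h2] _ _; split.
Qed.

(** * The noncommutative part *)

(** The odd moments cancel, so the difference decouples into a block on X, Y and a block on the
    words of even length. *)
Lemma M2_sub_LmxE (R : realType) (beta : word -> R) a b c d e (n := beta [::] - a)
    (p := beta [:: lX; lX] - b) (q := beta [:: lX; lY] - c)
    (r := beta [:: lX; lX; lX; lX] - d) (s := beta [:: lX; lX; lX; lY] - e)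
    (w := beta [:: lX; lY; lX; lY] - (b - d)) :
  circle_sequence beta ->
  M2 beta - Lmx beta a b c d e = \matrix_(i, j) nth 0 (nth [::]
    [:: [:: n; 0; 0; p; q; q; n - p];
        [:: 0; p; q; 0; 0; 0; 0];
        [:: 0; q; n - p; 0; 0; 0; 0];
        [:: p; 0; 0; r; s; s; p - r];
        [:: q; 0; 0; s; p - r; w; q - s];
        [:: q; 0; 0; s; w; p - r; q - s];
        [:: n - p; 0; 0; p - r; q - s; q - s; n - p *+ 2 + r]] i) j.
Proof.
rewrite /n /p /q /r /s /w => hb; apply/matrixP => i j; rewrite !mxE.
case: i => [[|[|[|[|[|[|[|//]]]]]]] li]; case: j => [[|[|[|[|[|[|[|//]]]]]]] lj];
by rewrite [beta _](circle_valueE hb) // /circle_value /=; ring.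
Qed.

(** Test vectors on 1, X^2, XY, YX; XY and YX keep separate coefficients so that they can be taken
    symmetric or antisymmetric. *)
Lemma M2_sub_Lmx_quad (R : realType) (beta : word -> R) a b c d e (n := beta [::] - a)
    (p := beta [:: lX; lX] - b) (q := beta [:: lX; lY] - c)
    (r := beta [:: lX; lX; lX; lX] - d) (s := beta [:: lX; lX; lX; lY] - e)
    (w := beta [:: lX; lY; lX; lY] - (b - d)) (z y1 y2 y3 : R) :
  circle_sequence beta -> psd (M2 beta - Lmx beta a b c d e) ->
  0 <= n * z ^+ 2 + 2 * p * z * y1 + 2 * q * z * (y2 + y3) + r * y1 ^+ 2 +
    2 * s * y1 * (y2 + y3) + (p - r) * (y2 ^+ 2 + y3 ^+ 2) + 2 * w * y2 * y3.
Proof.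
move=> hb [_ h]; move: (h (\col_i nth 0 [:: z; 0; 0; y1; y2; y3; 0] i)).
rewrite M2_sub_LmxE // -/n -/p -/q -/r -/s -/w quadE.
under eq_bigr => i _ do under eq_bigr => j _ do rewrite !mxE.
rewrite !big_ord_recl !big_ord0 /=; congr (_ <= _); ring.
Qed.

(* The moments of the noncommutative part: n, p, q, r, s are those of 1, X^2, XY, X^4, X^3Y,
   and g is that of ((XY + YX) / 2)^2. *)
Lemma disk_moment_ineq (R : realType) (n p q r s g : R) :
  (forall z y1 y2, 0 <= n * z ^+ 2 + 2 * p * z * y1 + 2 * q * z * y2 + r * y1 ^+ 2 +
    2 * s * y1 * y2 + g * y2 ^+ 2) -> 0 < p - r - g ->
  [/\ 0 < n, 0 < p, q ^+ 2 < p * (n - p) & q ^+ 2 < n * (p - r)].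
Proof.
move=> h pos.
have n0 : 0 <= n by have := h 1 0 0; congr (_ <= _); ring.
have r0 : 0 <= r by have := h 0 1 0; congr (_ <= _); ring.
have g0 : 0 <= g by have := h 0 0 1; congr (_ <= _); ring.
have p0 : 0 < p by lra.
have n1 : 0 < n.
  rewrite lt0r n0 andbT; apply/eqP => nz.
  (* If n were 0, this test vector would give - 4 p^2. *)
  have := h (- (r + 1)) (p *+ 2) 0; rewrite nz.
  have -> : 0 * (- (r + 1)) ^+ 2 + 2 * p * - (r + 1) * (p *+ 2) + 2 * q * - (r + 1) * 0 +
    r * (p *+ 2) ^+ 2 + 2 * s * (p *+ 2) * 0 + g * 0 ^+ 2 = - (p ^+ 2 *+ 4) by ring.
  by rewrite oppr_ge0 leNgt => /negP; apply; rewrite mulrn_wgt0 // exprn_gt0.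
have pr : p ^+ 2 <= n * r.
  rewrite -subr_ge0 -(pmulr_rge0 _ n1); have := h (- p) n 0.
  by congr (_ <= _); ring.
have qg : q ^+ 2 <= n * g.
  rewrite -subr_ge0 -(pmulr_rge0 _ n1); have := h (- q) 0 n.
  by congr (_ <= _); ring.
have ng : n * g < n * (p - r) by rewrite ltr_pM2l //; lra.
split=> //; last by apply: le_lt_trans ng.
(* The chain is p (n - p) = np - p^2 >= n (p - r) > n g >= q^2. *)
by have -> : p * (n - p) = n * p - p ^+ 2; [ring | move: ng; rewrite mulrBr; lra].
Qed.

(** Equal coefficients on XY and YX give the form in 1, X^2, (XY + YX) / 2. Opposite ones give p - r
    - w >= 0; here b and d cancel and leave beta_{X^2Y^2} - beta_{XYXY}, which is nonzero, and p - r
    - g is half of it. *)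
Lemma nc_part_ineq (R : realType) (beta : word -> R) a b c d e (n := beta [::] - a)
    (p := beta [:: lX; lX] - b) (q := beta [:: lX; lY] - c)
    (r := beta [:: lX; lX; lX; lX] - d) (s := beta [:: lX; lX; lX; lY] - e)
    (w := beta [:: lX; lY; lX; lY] - (b - d)) (g := (p - r + w) / 2) :
  circle_sequence beta -> nc_sequence beta -> psd (M2 beta - Lmx beta a b c d e) ->
  (forall z y1 y2, 0 <= n * z ^+ 2 + 2 * p * z * y1 + 2 * q * z * y2 + r * y1 ^+ 2 +
    2 * s * y1 * y2 + g * y2 ^+ 2) /\ 0 < p - r - g.
Proof.
move=> hb hnc hD; split=> [z y1 y2|].
  have := M2_sub_Lmx_quad z y1 (y2 / 2) (y2 / 2) hb hD.
  by rewrite -/n -/p -/q -/r -/s -/w /g; congr (_ <= _); field.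
have := M2_sub_Lmx_quad 0 0 1 (- 1) hb hD; rewrite -/n -/p -/q -/r -/s -/w => h.
have : p - r != w.
  apply/eqP; rewrite /p /r /w => h2; apply: hnc.
  by rewrite (circle_valueE hb) // /circle_value /=; lra.
by rewrite /g; move=> /eqP ne; rewrite lt0r; apply/andP; split; [apply/eqP; lra | lra].
Qed.

Lemma binary_form_gt0 (R : realType) (al be ga x y : R) :
  0 < al -> be ^+ 2 < al * ga -> (x != 0) || (y != 0) ->
  0 < al * x ^+ 2 + 2 * be * x * y + ga * y ^+ 2.
Proof.
move=> al0 h xy; rewrite -(pmulr_rgt0 _ al0).
have -> : al * (al * x ^+ 2 + 2 * be * x * y + ga * y ^+ 2) =
  (al * x + be * y) ^+ 2 + (al * ga - be ^+ 2) * y ^+ 2 by ring.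
have [y0|y0] := eqVneq y 0.
  move: xy; rewrite y0 eqxx orbF mulr0 addr0 expr0n mulr0 addr0 => x0.
  by rewrite exprn_even_gt0 //= mulf_neq0 // gt_eqF.
by rewrite ltr_wpDl ?sqr_ge0 // mulr_gt0 ?subr_gt0 // exprn_even_gt0.
Qed.

Lemma binary_form_ge0 (R : realType) (al be ga x y : R) :
  0 < al -> be ^+ 2 < al * ga -> 0 <= al * x ^+ 2 + 2 * be * x * y + ga * y ^+ 2.
Proof.
move=> al0 h; have [/andP[/eqP-> /eqP->]|] := boolP ((x == 0) && (y == 0)).
  by rewrite expr0n /= !mulr0 !addr0.
by rewrite negb_and => /(binary_form_gt0 al0 h) /ltW.
Qed.

(** The 4 x 4 matrix decouples into the blocks on 1, XY and on X, Y; the four inequalities of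
    [disk_moment_ineq] are their leading minors. *)
Lemma nc_part_posdef (R : realType) (beta : word -> R) a b c d e :
  circle_sequence beta -> nc_sequence beta -> psd (M2 beta - Lmx beta a b c d e) ->
  posdef (principal_submx [:: [::]; [:: lX]; [:: lY]; [:: lX; lY]]
            (M2 beta - Lmx beta a b c d e)).
Proof.
move=> hb hnc hD; have [hq pos] := nc_part_ineq hb hnc hD.
have [n0 p0 pn nu] := disk_moment_ineq hq pos.
split; first by rewrite /principal_submx trmx_mxsub (proj1 hD).
move=> v v0; rewrite quadE M2_sub_LmxE //.
move: n0 p0 pn nu; set n := _ - a; set p := _ - b; set q := _ - c.
set r := beta [:: lX; lX; lX; lX] - d.
move=> n0 p0 pn nu.
under eq_bigr => i _ do under eq_bigr => j _ do rewrite !mxE /idx.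
rewrite !big_ord_recl !big_ord0 /= !inordK //=.
set z : R := v ord0 0; set x1 : R := v (lift ord0 ord0) 0.
set x2 : R := v (lift ord0 (lift ord0 ord0)) 0; set y : R := v _ 0.
rewrite [ltRHS](_ : _ = (n * z ^+ 2 + 2 * q * z * y + (p - r) * y ^+ 2) +
  (p * x1 ^+ 2 + 2 * q * x1 * x2 + (n - p) * x2 ^+ 2)); last by ring.
have [zy xx] := (binary_form_ge0 z y n0 nu, binary_form_ge0 x1 x2 p0 pn).
have [/andP[/eqP z0 /eqP y0]|] := boolP ((z == 0) && (y == 0)); last first.
  by rewrite negb_and => /(binary_form_gt0 n0 nu) zy'; exact: ltr_pwDl.
have [/andP[/eqP x10 /eqP x20]|] := boolP ((x1 == 0) && (x2 == 0)); last first.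
  by rewrite negb_and => /(binary_form_gt0 p0 pn) xx'; exact: ltr_wpDl.
case/eqP: v0; apply/matrixP => i j; rewrite (ord1 j) [RHS]mxE.
case: i => [[|[|[|[|//]]]]] li.
- by rewrite -[RHS]z0; congr (v _ _); apply: val_inj.
- by rewrite -[RHS]x10; congr (v _ _); apply: val_inj.
- by rewrite -[RHS]x20; congr (v _ _); apply: val_inj.
- by rewrite -[RHS]y0; congr (v _ _); apply: val_inj.
Qed.

(** * The variety *)

Lemma Lmx_measure (R : realType) (beta : word -> R) (a b c d e : R) :
  psd (Lmx beta a b c d e) ->
  exists s : seq (R * (R * R)), (forall u, u \in s -> 0 < u.1) /\
    Lmx beta a b c d e = \sum_(u <- s) u.1 *: (circle_mon u.2 *m (circle_mon u.2)^T).
Proof.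
move=> /circle_measure[s [s0 s1 [hs ha [hb hc] [hd he]]]]; exists s; split=> //.
rewrite -Lmx_circle // -hb -hc -hd -he.
have -> : \sum_(u <- s) u.1 * 1 = a by rewrite ha; apply: eq_bigr => u _; rewrite mulr1.
by apply: eq_Lmx; apply: hs; rewrite !inE eqxx ?orbT.
Qed.

Definition mon_idx (m : 'X_{1..2}) : 'I_7 := idx (nseq (m ord0) lX ++ nseq (m ord_max) lY).

Lemma circle_mon_idx (R : realType) (p : R * R) (m : 'X_{1..2}) : (mdeg m < 3)%N ->
  circle_mon p (mon_idx m) 0 =
  \prod_i (if i == ord0 then p.1 else p.2) ^+ m i.
Proof.
rewrite mdegE !big_ord_recl !big_ord0 addn0 mulr1 /=.
have -> : lift ord0 ord0 = ord_max :> 'I_2 by apply: val_inj.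
rewrite /mon_idx /idx; move: (m ord0) (m ord_max) => i j ij; rewrite !mxE inordK.
  by case: i ij => [|[|[|i]]]; case: j => [|[|[|j]]] //= _; ring.
by case: i ij => [|[|[|i]]]; case: j => [|[|[|j]]].
Qed.

(** If the column g(X,Y) is 0, the form of L at the coefficients of g is 0; but it is the sum of the
    weights times g^2 at the points, so g vanishes at each of them. *)
Lemma measure_variety (R : realType) (s : seq (R * (R * R))) (u : R * (R * R)) :
  (forall v, v \in s -> 0 < v.1) -> u \in s ->
  variety (\sum_(v <- s) v.1 *: (circle_mon v.2 *m (circle_mon v.2)^T)) u.2.
Proof.
move=> s0 us g sg; set L := \sum_(v <- s) _ => Lg.
pose V : 'cV[R]_7 := \sum_(m <- msupp g) g@_m *: delta_mx (mon_idx m) 0.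
have LV : L *m V = 0.
  rewrite -Lg /V /poly_col mulmx_sumr; apply: eq_bigr => m _.
  by rewrite -scalemxAr -colE.
have evalE (p : R * R) : ((circle_mon p)^T *m V) 0 0 =
    g.@[fun i : 'I_2 => if i == ord0 then p.1 else p.2].
  rewrite mevalE /V mulmx_sumr summxE; apply: eq_big_seq => m mg.
  rewrite -scalemxAr -colE [LHS]mxE [X in _ * X]mxE [X in _ * X]mxE circle_mon_idx //.
  exact: leq_trans (msize_mdeg_lt mg) sg.
have : (V^T *m (L *m V)) 0 0 = \sum_(v <- s) v.1 * ((circle_mon v.2)^T *m V) 0 0 ^+ 2.
  rewrite /L mulmx_suml mulmx_sumr summxE; apply: eq_bigr => v _.
  rewrite -scalemxAl -scalemxAr [LHS]mxE; congr (_ * _).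
  rewrite -(mulmxA _ _ V) (mulmxA V^T) [LHS]mxE big_ord_recl big_ord0 addr0 expr2.
  congr (_ * _).
  by rewrite -[in RHS](trmxK V) -trmx_mul [RHS]mxE.
rewrite LV mulmx0 mxE big_seq => /esym /eqP; rewrite psumr_eq0 => [|v /s0 v0]; last first.
  by rewrite mulr_ge0 ?sqr_ge0 // ltW.
move=> /allP /(_ u us); rewrite us /= mulf_eq0 gt_eqF ?s0 //= sqrf_eq0 => /eqP.
by rewrite evalE.
Qed.

(** Every row of the sum is a combination of the monomial vectors of the distinct points. *)
Lemma measure_rank (R : realType) (s : seq (R * (R * R))) :
  (\rank (\sum_(v <- s) v.1 *: (circle_mon v.2 *m (circle_mon v.2)^T))%R
   <= size (undup [seq v.2 | v <- s]))%N.
Proof.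
set pts := undup _.
pose M : 'M[R]_(size pts, 7) := \matrix_i (circle_mon (nth (0, 0) pts i))^T.
apply: leq_trans (rank_leq_row M); apply: mxrankS.
rewrite big_seq; apply: summx_sub => v vs; apply: scalemx_sub; apply: mulmx_sub.
have vp : v.2 \in pts by rewrite mem_undup map_f.
have vi : (index v.2 pts < size pts)%N by rewrite index_mem.
by have := row_sub (Ordinal vi) M; rewrite rowK /= nth_index.
Qed.

Lemma rank_le_variety (R : realType) (beta : word -> R) (a b c d e : R) :
  psd (Lmx beta a b c d e) ->
  (`I_(\rank (Lmx beta a b c d e)) #<= variety (Lmx beta a b c d e))%card.
Proof.
move=> /Lmx_measure[s [s0 ->]]; have := measure_rank s.
set L := \sum_(v <- s) _; set pts := undup _ => rk.
have inj : {in `I_(\rank L) &, injective (nth (0, 0) pts)}%classic.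
  move=> i j; rewrite !inE /= => li lj /eqP.
  by rewrite nth_uniq ?undup_uniq ?(leq_trans _ rk) // => /eqP.
rewrite -(card_le_eql (inj_card_eq inj)); apply: subset_card_le => _ [i /= li <-].
have : nth (0, 0) pts i \in pts by rewrite mem_nth // (leq_trans li).
rewrite mem_undup => /mapP[u us ->]; exact: measure_variety.
Qed.

(** * Measures on the disk *)

(** The disk with centre (1/2, 0) and radius 1/2. The inequality is Cauchy-Schwarz for the
    normalized trace ga of AB when A^2 = al and B^2 = 1 - al. *)
Definition in_disk (R : realType) (p : R * R) : bool := p.2 ^+ 2 <= p.1 * (1 - p.1).

Definition quadratic (R : realType) (A B C D E F x y : R) : R :=
  A + B * x + C * y + D * x ^+ 2 + E * x * y + F * y ^+ 2.

(* The two endpoints of the chord through m in direction u, weighted so as to have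
   barycentre m; the product of their distances to m is the power rho of m. *)
Lemma chord_measure (R : realType) (m1 m2 u1 u2 : R) (rho := m1 - m1 ^+ 2 - m2 ^+ 2) :
  0 < rho -> exists l : seq (R * (R * R)),
   (forall v, v \in l -> 0 < v.1 /\ in_disk v.2) /\
   forall A B C D E F, \sum_(v <- l) v.1 * quadratic A B C D E F v.2.1 v.2.2 =
     (u1 ^+ 2 + u2 ^+ 2) / rho * quadratic A B C D E F m1 m2 +
     (D * u1 ^+ 2 + E * u1 * u2 + F * u2 ^+ 2).
Proof.
move=> rho0; set N := u1 ^+ 2 + u2 ^+ 2.
have N_ge0 : 0 <= N by rewrite addr_ge0 ?sqr_ge0.
have [N0|N0] := eqVneq N 0.
  exists [::]; split=> // A B C D E F; rewrite big_nil N0 mul0r mul0r add0r.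
  have [/eqP h1 /eqP h2] : u1 == 0 /\ u2 == 0.
    by move/eqP: N0; rewrite paddr_eq0 ?sqr_ge0 // !sqrf_eq0 => /andP[].
  by rewrite h1 h2; ring.
have N_gt0 : 0 < N by rewrite lt0r N0.
(* At m + t u the power becomes rho + t be - t^2 N. Its roots are [ta] and - [si], with opposite
   signs since rho > 0. *)
pose be := u1 - 2 * m1 * u1 - 2 * m2 * u2.
pose De := Num.sqrt (be ^+ 2 + 4 * rho * N).
have rN : 0 < 4 * rho * N by rewrite !mulr_gt0.
have De2 : De ^+ 2 = be ^+ 2 + 4 * rho * N.
  by rewrite sqr_sqrtr // addr_ge0 ?sqr_ge0 // ltW.
have beDe : `|be| < De.
  rewrite -(ltr_pXn2r (n := 2)) ?nnegrE ?sqrtr_ge0 // De2 real_normK ?num_real //.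
  by rewrite ltrDl.
pose ta := (De + be) / (2 * N); pose si := (De - be) / (2 * N).
have N2 : 0 < 2 * N by rewrite mulr_gt0.
move: beDe; rewrite ltr_norml => /andP[be1 be2].
have ta0 : 0 < ta by rewrite divr_gt0 //; lra.
have si0 : 0 < si by rewrite divr_gt0 //; lra.
have De_be : be = N * (ta - si) by rewrite /ta /si; field.
have tasi : rho = N * ta * si.
  suff -> : N * ta * si = (De ^+ 2 - be ^+ 2) / (4 * N) by rewrite De2; field.
  by rewrite /ta /si; field.
have ts0 : 0 < ta + si by rewrite addr_gt0.
have ts_neq0 : ta + si != 0 by rewrite gt_eqF.
have ta_neq0 : ta != 0 by rewrite gt_eqF.
have si_neq0 : si != 0 by rewrite gt_eqF.
(* With unit mass the covariance would be ta si = rho / N times that of u; total mass N / rho makes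
   it exactly u u^T. *)
exists [:: (N / rho * (si / (ta + si)), (m1 + ta * u1, m2 + ta * u2));
           (N / rho * (ta / (ta + si)), (m1 - si * u1, m2 - si * u2))].
have disk t : rho + t * be - t ^+ 2 * N = 0 -> in_disk (m1 + t * u1, m2 + t * u2).
  rewrite /rho /be /N /in_disk /= -subr_ge0 => h.
  rewrite [leRHS](_ : _ = m1 - m1 ^+ 2 - m2 ^+ 2 + t * (u1 - 2 * m1 * u1 - 2 * m2 * u2)
    - t ^+ 2 * (u1 ^+ 2 + u2 ^+ 2)); [by rewrite h | ring].
split=> [v|A B C D E F].
  rewrite !inE => /orP[] /eqP -> /=; split.
  - by apply: mulr_gt0; apply: divr_gt0.
  - by apply: disk; rewrite De_be tasi; ring.
  - by apply: mulr_gt0; apply: divr_gt0.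
  - by have := disk (- si); rewrite !mulNr; apply; rewrite De_be tasi; ring.
rewrite !big_cons big_nil /= /quadratic tasi; field.
by rewrite N0 ta_neq0 si_neq0.
Qed.

(** Put m at the barycentre and let K be n times the covariance. Chords along the columns of a
    Cholesky factor of K produce K and use mass tr K / rho, where n rho = tr K + (p - r - g); this
    is less than n, and the remaining mass sits at m. *)
Lemma disk_measure (R : realType) (n p q r s g : R) :
  (forall z y1 y2, 0 <= n * z ^+ 2 + 2 * p * z * y1 + 2 * q * z * y2 + r * y1 ^+ 2 +
    2 * s * y1 * y2 + g * y2 ^+ 2) -> 0 < p - r - g ->
  exists l : seq (R * (R * R)), (forall v, v \in l -> 0 < v.1 /\ in_disk v.2) /\
   forall A B C D E F, \sum_(v <- l) v.1 * quadratic A B C D E F v.2.1 v.2.2 =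
     A * n + B * p + C * q + D * r + E * s + F * g.
Proof.
move=> h pos; have [n0 _ _ _] := disk_moment_ineq h pos.
have n_neq0 : n != 0 by rewrite gt_eqF.
pose m1 := p / n; pose m2 := q / n.
pose K11 := r - p ^+ 2 / n; pose K12 := s - p * q / n; pose K22 := g - q ^+ 2 / n.
have K_ge0 y1 y2 : 0 <= K11 * y1 ^+ 2 + 2 * K12 * y1 * y2 + K22 * y2 ^+ 2.
  (* This z minimizes the form for given y1, y2, which leaves the Schur complement K. *)
  have := h (- (p * y1 + q * y2) / n) y1 y2.
  by congr (_ <= _); rewrite /K11 /K12 /K22; field.
have K11_ge0 : 0 <= K11 by have := K_ge0 1 0; congr (_ <= _); ring.
have K22_ge0 : 0 <= K22 by have := K_ge0 0 1; congr (_ <= _); ring.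
have K12_0 : K11 = 0 -> K12 = 0.
  move=> K0; apply/eqP/negPn/negP => K12_neq0.
  have := K_ge0 (- (K22 + 1)) (K12 *+ 2); rewrite K0.
  have -> : 0 * (- (K22 + 1)) ^+ 2 + 2 * K12 * - (K22 + 1) * (K12 *+ 2) + K22 * (K12 *+ 2) ^+ 2
     = - (K12 ^+ 2 *+ 4) by ring.
  by rewrite oppr_ge0 leNgt => /negP; apply; rewrite mulrn_wgt0 // exprn_even_gt0.
have K_det : 0 <= K22 - K12 ^+ 2 / K11.
  have [K0|K0] := eqVneq K11 0; first by rewrite (K12_0 K0) expr0n mul0r subr0.
  have := K_ge0 (- K12 / K11) 1; congr (_ <= _); by field.
pose rho := m1 - m1 ^+ 2 - m2 ^+ 2.
have rhoE : n * rho = (K11 + K22) + (p - r - g).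
  by rewrite /rho /m1 /m2 /K11 /K22; field.
have rho0 : 0 < rho.
  by rewrite -(pmulr_rgt0 _ n0) rhoE ltr_wpDl // addr_ge0.
(* The two columns of the Cholesky factor. If K11 = 0 then K12 = 0, and the quotients by 0 are 0 as
   required. *)
have [l1 [l1P l1E]] := chord_measure (Num.sqrt K11) (K12 / Num.sqrt K11) rho0.
have [l2 [l2P l2E]] := chord_measure 0 (Num.sqrt (K22 - K12 ^+ 2 / K11)) rho0.
exists ((n - (K11 + K22) / rho, (m1, m2)) :: l1 ++ l2); split=> [v|A B C D E F].
  rewrite inE mem_cat => /or3P[/eqP->|/l1P//|/l2P//]; split=> /=.
    by rewrite subr_gt0 ltr_pdivrMr // rhoE ltrDl.
  by rewrite /in_disk /= -subr_ge0; move/ltW: rho0; rewrite /rho; congr (_ <= _); ring.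
rewrite big_cons big_cat l1E l2E /= -/rho.
have s1 : Num.sqrt K11 ^+ 2 = K11 by rewrite sqr_sqrtr.
have s2 : Num.sqrt (K22 - K12 ^+ 2 / K11) ^+ 2 = K22 - K12 ^+ 2 / K11 by rewrite sqr_sqrtr.
have s12 : Num.sqrt K11 * (K12 / Num.sqrt K11) = K12.
  have [K0|K0] := eqVneq K11 0; first by rewrite (K12_0 K0) mul0r mulr0.
  by rewrite mulrCA divff ?mulr1 // sqrtr_eq0 -ltNge lt0r K0.
have s22 : (K12 / Num.sqrt K11) ^+ 2 = K12 ^+ 2 / K11 by rewrite expr_div_n s1.
rewrite s1 s2 s22 -(mulrA E) s12 expr0n /=.
have rho_neq0 : rho != 0 by rewrite gt_eqF.
transitivity (n * quadratic A B C D E F m1 m2 + D * K11 + E * K12 + F * K22).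
  by move: (K12 ^+ 2 / K11) => t; field.
by rewrite /quadratic /m1 /m2 /K11 /K12 /K22; field.
Qed.

(** * Construction of a representing measure *)

Definition mx2 (R : realType) (a b c d : R) : 'M[R]_2 :=
  \matrix_(i, j) nth 0 (nth [::] [:: [:: a; b]; [:: c; d]] i) j.

Lemma mx2_mul (R : realType) (a b c d a' b' c' d' : R) :
  mx2 a b c d *m mx2 a' b' c' d' =
  mx2 (a * a' + b * c') (a * b' + b * d') (c * a' + d * c') (c * b' + d * d').
Proof.
apply/matrixP => i j; rewrite !mxE !big_ord_recl big_ord0 !mxE addr0.
by case: i => [[|[|//]] li]; case: j => [[|[|//]] lj].
Qed.

Lemma mx2_1 (R : realType) : 1%:M = mx2 1 0 0 1 :> 'M[R]_2.
Proof.
apply/matrixP => i j; rewrite !mxE.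
by case: i => [[|[|//]] li]; case: j => [[|[|//]] lj].
Qed.

Lemma mx2_tr (R : realType) (a b c d : R) : \tr (mx2 a b c d) = a + d.
Proof. by rewrite /mxtrace !big_ord_recl big_ord0 !mxE addr0. Qed.

Definition point_atom (R : realType) (u : R * (R * R)) : atom R :=
  @Atom R 1 u.1 u.2.1%:M u.2.2%:M.

(* A pair of symmetric 2 x 2 matrices with A^2 = al, B^2 = 1 - al and AB + BA = 2 ga; at
   al = 0 one has ga = 0 and the quotients are 0. *)
Definition disk_atom (R : realType) (u : R * (R * R)) : atom R :=
  let al := u.2.1 in let ga := u.2.2 in
  let x := ga / Num.sqrt al in let y := Num.sqrt (1 - al - ga ^+ 2 / al) in
  @Atom R 2 u.1 (mx2 (Num.sqrt al) 0 0 (- Num.sqrt al)) (mx2 x y y (- x)).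

Definition atom_circle (R : realType) (u : atom R) : Prop :=
  aX u *m aX u + aY u *m aY u = 1%:M.

Lemma point_atom_wf (R : realType) (u : R * (R * R)) : 0 < u.1 -> atom_wf (point_atom u).
Proof. by move=> u0; split=> //=; rewrite tr_scalar_mx. Qed.

Lemma point_atom_circle (R : realType) (u : R * (R * R)) :
  u.2.1 ^+ 2 + u.2.2 ^+ 2 = 1 -> atom_circle (point_atom u).
Proof. by move=> h; rewrite /atom_circle /= -!scalar_mxM -!expr2 -raddfD h. Qed.

Lemma point_atom_moment (R : realType) (u : R * (R * R)) w :
  ntr (wmx (aX (point_atom u)) (aY (point_atom u)) w) = point_moment u.2 w.
Proof.
rewrite /ntr divr1 /=; have -> : wmx u.2.1%:M u.2.2%:M w = (point_moment u.2 w)%:M :> 'M_1.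
  rewrite /point_moment; elim: w => [|l w IH] /=; first by rewrite mulr1.
  by case: l; rewrite /= IH -scalar_mxM ?add0n ?add1n exprS; congr _%:M; ring.
by rewrite mxtrace_scalar.
Qed.

Lemma disk_atom_param (R : realType) (al ga : R) (x := ga / Num.sqrt al)
    (y := Num.sqrt (1 - al - ga ^+ 2 / al)) : in_disk (al, ga) ->
  [/\ Num.sqrt al ^+ 2 = al, Num.sqrt al * x = ga & x ^+ 2 + y ^+ 2 = 1 - al].
Proof.
rewrite /in_disk /= => h.
have al0 : 0 <= al.
  rewrite leNgt; apply/negP => al0; have : al * (1 - al) < 0.
    by rewrite nmulr_rlt0 // subr_gt0 (lt_trans al0).
  by move/(le_lt_trans h); rewrite ltNge sqr_ge0.
have al2 : Num.sqrt al ^+ 2 = al by rewrite sqr_sqrtr.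
have [z|nz] := eqVneq al 0.
  have /eqP : ga ^+ 2 == 0 by rewrite eq_le sqr_ge0 andbT; move: h; rewrite z mul0r.
  move=> /eqP; rewrite sqrf_eq0 => /eqP ga0; rewrite /x /y ga0 !mul0r expr0n /= mul0r z.
  by rewrite !subr0 sqrtr1 sqrtr0 mulr0 expr0n expr1n add0r.
have s0 : Num.sqrt al != 0 by rewrite sqrtr_eq0 -ltNge lt0r nz.
split=> //; first by rewrite /x mulrCA divff ?mulr1.
rewrite /x /y expr_div_n al2 sqr_sqrtr; first by rewrite addrC subrK.
by rewrite subr_ge0 ler_pdivrMr ?lt0r ?nz // mulrC.
Qed.

Lemma disk_atom_wf (R : realType) (u : R * (R * R)) : 0 < u.1 -> atom_wf (disk_atom u).
Proof.
move=> u0; split=> //=; apply/matrixP => i j; rewrite !mxE;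
by case: i => [[|[|//]] li]; case: j => [[|[|//]] lj].
Qed.

Lemma disk_atom_circle (R : realType) (u : R * (R * R)) :
  in_disk u.2 -> atom_circle (disk_atom u).
Proof.
case: u => w [al ga] /= /disk_atom_param; rewrite /atom_circle /=.
set a := Num.sqrt al; set x := _ / a; set y := Num.sqrt _ => -[a2 ax xy].
rewrite !mx2_mul mx2_1; apply/matrixP => i j; rewrite !mxE.
by case: i => [[|[|//]] li]; case: j => [[|[|//]] lj] /=;
  first [ring | apply: (lincomb (k := 1) (f_equal2 +%R a2 xy)); ring].
Qed.

(** The value at XYXY comes from ABAB = 2 ga AB - A^2 B^2, AB having normalized trace ga. Odd words
    fall outside the list and get the default 0, their actual trace. *)
Definition disk_moment (R : realType) (p : R * R) (w : word) : R :=
  nth 0 [:: 1; p.1; p.2; p.1 ^+ 2; p.1 * p.2; p.2 ^+ 2 *+ 2 - p.1 * (1 - p.1)]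
   (index w [:: [::]; [:: lX; lX]; [:: lX; lY]; [:: lX; lX; lX; lX]; [:: lX; lX; lX; lY];
      [:: lX; lY; lX; lY]]).

Lemma disk_atom_moment (R : realType) (u : R * (R * R)) w : in_disk u.2 ->
  w \in [:: [::]; [:: lX]; [:: lY]; [:: lX; lX]; [:: lX; lY];
     [:: lX; lX; lX]; [:: lX; lX; lY]; [:: lX; lX; lX; lX]; [:: lX; lX; lX; lY];
     [:: lX; lY; lX; lY]] ->
  ntr (wmx (aX (disk_atom u)) (aY (disk_atom u)) w) = disk_moment u.2 w.
Proof.
case: u => p [al ga] /= /disk_atom_param.
set a := Num.sqrt al; set x := _ / a; set y := Num.sqrt _ => -[a2 ax xy].
clearbody a x y; subst al ga.
rewrite !inE /ntr => hw.
do ?[move: hw => /orP[/eqP ->|hw];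
  first by rewrite /= mx2_1 ?mx2_mul mx2_tr /disk_moment /=; field].
move: hw => /eqP ->; rewrite /= mx2_1 ?mx2_mul mx2_tr /disk_moment /=.
by apply: (lincomb (k := - a ^+ 2) xy); field.
Qed.

Lemma psd_represents (R : realType) (beta : word -> R) a b c d e :
  circle_sequence beta -> normalized beta -> nc_sequence beta ->
  psd (Lmx beta a b c d e) -> psd (M2 beta - Lmx beta a b c d e) ->
  exists mu, represents mu beta.
Proof.
move=> hb h1 hnc hL hD.
have [s [s0 s1 [hs ha [hbb hc] [hd he]]]] := circle_measure hL.
have [hq pos] := nc_part_ineq hb hnc hD.
have [l [l0 lE]] := disk_measure hq pos.
pose mu := [seq point_atom u | u <- s] ++ [seq disk_atom u | u <- l].
have muP i : atom_wf (tnth (in_tuple mu) i) /\ atom_circle (tnth (in_tuple mu) i).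
  have : all (fun u => `[< atom_wf u /\ atom_circle u >]) (in_tuple mu).
    rewrite /= all_cat !all_map; apply/andP; split; apply/allP => u us; apply/asboolP.
      by split; [apply/point_atom_wf/s0 | apply/point_atom_circle/s1].
    by have [u0 u1] := l0 _ us; split; [exact: disk_atom_wf | exact: disk_atom_circle].
  by move=> /all_tnthP /(_ i) /asboolP.
pose F w := \sum_(u <- mu) aweight u * ntr (wmx (aX u) (aY u) w).
have hF : circle_sequence F.
  rewrite /F; under boolp.eq_fun do rewrite big_tnth.
  apply: circle_sequence_sum => i _; case: (muP i) => -[t0 _ hA hB] AB.
  have := trace_circle_sequence hA hB (trmx1 _ _) _ _ AB.
  rewrite !mulmx1 !mul1mx => /(_ erefl erefl) [h2 h3].
  have ntrE w : ntr (wmx (aX (tnth (in_tuple mu) i)) (aY (tnth (in_tuple mu) i)) w) =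
     trace_moment (aX (tnth (in_tuple mu) i)) (aY (tnth (in_tuple mu) i)) 1%:M w /
       (asize (tnth (in_tuple mu) i))%:R by rewrite /trace_moment mulmx1.
  split=> w sw; last by rewrite !ntrE h3 // mulrBl.
  by have [h4 h5] := h2 w sw; split=> [k|]; rewrite !ntrE ?h4 ?h5.
have FE w : w \in [:: [::]; [:: lX]; [:: lY]; [:: lX; lX]; [:: lX; lY];
     [:: lX; lX; lX]; [:: lX; lX; lY]; [:: lX; lX; lX; lX]; [:: lX; lX; lX; lY];
     [:: lX; lY; lX; lY]] -> F w = \sum_(u <- s) u.1 * point_moment u.2 w +
       \sum_(u <- l) u.1 * disk_moment u.2 w.
  move=> hw; rewrite /F big_cat !big_map /=; congr (_ + _).
    by apply: eq_bigr => u _; rewrite -point_atom_moment.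
  by apply: eq_big_seq => u /l0[_ hu]; rewrite -disk_atom_moment.
have bF : forall w, (size w <= 4)%N -> beta w = F w.
  apply: eq_circle_sequence => // w hw; rewrite FE //; move: hw.
  have lmom A B C D E G (v : word) :
      (forall p, disk_moment p v = quadratic A B C D E G p.1 p.2) ->
      \sum_(u <- l) u.1 * disk_moment u.2 v = A * (beta [::] - a) +
        B * (beta [:: lX; lX] - b) + C * (beta [:: lX; lY] - c) +
        D * (beta [:: lX; lX; lX; lX] - d) + E * (beta [:: lX; lX; lX; lY] - e) +
        G * ((beta [:: lX; lX] - b - (beta [:: lX; lX; lX; lX] - d) +
              (beta [:: lX; lY; lX; lY] - (b - d))) / 2).
    by move=> vE; rewrite -lE; apply: eq_bigr => u _; rewrite vE.
  have smom (v : word) t (f : R * R -> R) : t = \sum_(u <- s) u.1 * f u.2 ->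
      (forall p, p.1 ^+ 2 + p.2 ^+ 2 = 1 -> point_moment p v = f p) ->
      \sum_(u <- s) u.1 * point_moment u.2 v = t.
    by move=> -> vE; apply: eq_big_seq => u us; rewrite vE // s1.
  have odd_mom v : v \in [:: [:: lX]; [:: lY]; [:: lX; lX; lX]; [:: lX; lX; lY]] ->
      beta v = \sum_(u <- s) u.1 * point_moment u.2 v + \sum_(u <- l) u.1 * disk_moment u.2 v.
    move=> hv; rewrite -hs // (lmom 0 0 0 0 0 0) => [|p]; first by ring.
    rewrite /quadratic /disk_moment; move: hv; rewrite !inE.
    by move=> /or4P[] /eqP -> /=; ring.
  have ha' : a = \sum_(u <- s) u.1 * 1 by rewrite ha; apply: eq_bigr => u _; rewrite mulr1.
  have hbd : b - d = \sum_(u <- s) u.1 * (u.2.1 ^+ 2 - u.2.1 ^+ 4).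
    by rewrite hbb hd -sumrB; apply: eq_bigr => u _; rewrite mulrBr.
  rewrite !inE; case/orP => [/eqP->|].
    rewrite (lmom 1 0 0 0 0 0) => [|p]; last by rewrite /quadratic /disk_moment /=; ring.
    by rewrite (smom _ _ (fun=> 1) ha') => [|p _]; rewrite ?/point_moment /=; ring.
  case/orP => [/eqP->|]; first exact: odd_mom.
  case/orP => [/eqP->|]; first exact: odd_mom.
  case/orP => [/eqP->|].
    rewrite (lmom 0 1 0 0 0 0) => [|p]; last by rewrite /quadratic /disk_moment /=; ring.
    by rewrite (smom _ _ (fun p => p.1 ^+ 2) hbb) => [|p _]; rewrite ?/point_moment /=; ring.
  case/orP => [/eqP->|].
    rewrite (lmom 0 0 1 0 0 0) => [|p]; last by rewrite /quadratic /disk_moment /=; ring.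
    by rewrite (smom _ _ (fun p => p.1 * p.2) hc) => [|p _]; rewrite ?/point_moment /=; ring.
  case/orP => [/eqP->|]; first exact: odd_mom.
  case/orP => [/eqP->|]; first exact: odd_mom.
  case/orP => [/eqP->|].
    rewrite (lmom 0 0 0 1 0 0) => [|p]; last by rewrite /quadratic /disk_moment /=; ring.
    by rewrite (smom _ _ (fun p => p.1 ^+ 4) hd) => [|p _]; rewrite ?/point_moment /=; ring.
  case/orP => [/eqP->|].
    rewrite (lmom 0 0 0 0 1 0) => [|p]; last by rewrite /quadratic /disk_moment /=; ring.
    by rewrite (smom _ _ (fun p => p.1 ^+ 3 * p.2) he) => [|p _]; rewrite ?/point_moment /=; ring.
  (* The disk part gives - p + r + 2 g = w; the circle points give b - d, as x^2 y^2 = x^2 - x^4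
     there. *)
  move=> /eqP ->; rewrite (lmom 0 (-1) 0 1 0 2) => [|p]; last first.
    by rewrite /quadratic /disk_moment /=; ring.
  rewrite (smom _ _ (fun p => p.1 ^+ 2 - p.1 ^+ 4) hbd) => [|p h]; first by field.
  by rewrite /point_moment /=; apply: (lincomb (k := p.1 ^+ 2) h); ring.
exists mu; split; [by move=> i; case: (muP i) | | exact: bF].
transitivity (F [::]); last by rewrite -(bF [::] isT); exact: h1.
rewrite /F [LHS]big_tnth [RHS]big_tnth; apply: eq_bigr => i _.
have [[t0 _ _ _] _] := muP i.
move: t0; clear; case: (tnth (in_tuple mu) i) => t w A B /= t0.
by rewrite /ntr mxtrace1 divff ?mulr1 // pnatr_eq0 -lt0n.
Qed.

(** * Minimal measures *)

Lemma ex_min_value (T : Type) (P : T -> Prop) (f : T -> nat) :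
  (exists x, P x) -> exists2 x, P x & forall y, P y -> (f x <= f y)%N.
Proof.
move=> [x0 Px0]; have ex : exists n, `[< exists2 x, P x & f x = n >].
  by exists (f x0); apply/asboolP; exists x0.
case: (ex_minnP ex) => n /asboolP[x Px <-] xmin; exists x => // y Py.
by apply: xmin; apply/asboolP; exists y.
Qed.

(** Entries are minimized from the last one down, following the order on types; k counts the entries
    already settled. *)
Lemma ex_lex_min (r k : nat) (P : seq nat -> Prop) : (k <= r)%N -> (exists m, P m) ->
  exists2 m, P m & forall m' j, P m' -> (r - k <= j < r)%N ->
    (forall i, (j < i < r)%N -> nth 0%N m' i = nth 0%N m i) -> (nth 0%N m j <= nth 0%N m' j)%N.
Proof.
move=> kr exP; elim: k kr => [|k IH] kr.
  by case: exP => m Pm; exists m => // m' j _; rewrite subn0 leqNgt andNb.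
have [m Pm mmin] := IH (ltnW kr).
pose P' m' := P m' /\ forall i, (r - k <= i < r)%N -> nth 0%N m' i = nth 0%N m i.
have [|m1 [Pm1 m1m] m1min] := @ex_min_value _ P' (fun m' => nth 0%N m' (r - k.+1)).
  by exists m.
exists m1 => // m' j Pm' /andP[kj jr] agree.
have [jk|jk] := ltnP j (r - k).
  have -> : j = (r - k.+1)%N by lia.
  apply: m1min; split=> // i /andP[ki ir]; rewrite agree ?ir ?(leq_trans jk) //.
  by apply: m1m; rewrite ki.
rewrite m1m ?jk //; apply: mmin; rewrite ?jk // => i /andP[ji ir].
by rewrite agree ?ji // m1m // ir andbT; lia.
Qed.

Lemma ex_min_type (P : seq nat -> Prop) : (exists m, P m) ->
  exists2 m, P m & forall m', P m' -> ~ type_lt m' m.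
Proof.
move=> exP; have [m0 Pm0 m0min] := ex_min_value size exP.
set r := size m0 in m0min.
have [|m [Pm sm] mmin] := @ex_lex_min r r (fun m => P m /\ size m = r) (leqnn r).
  by exists m0.
exists m => // m' Pm' [|[ss [j [jm lt_j agree]]]].
  by rewrite sm ltnNge m0min.
have sm' : size m' = r by rewrite ss sm.
move: lt_j; apply/negP; rewrite -leqNgt; apply: mmin => //.
  by rewrite subnn /= -sm'.
by move=> i ij; apply: agree; rewrite sm'.
Qed.

Lemma represents_has_type (R : realType) (mu : seq (atom R)) (beta : word -> R) :
  represents mu beta -> exists m, has_type mu m.
Proof.
move=> [wf w1 _]; pose sz i := asize (tnth (in_tuple mu) i).
have mu0 : (0 < #|'I_(size mu)|)%N.
  rewrite card_ord lt0n; apply/eqP => /size0nil mu0.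
  by move/eqP: w1; rewrite mu0 big_nil eq_sym oner_eq0.
pose r := (\max_i sz i)%N.
have [i0 ri0] := @bigop.eq_bigmax _ sz mu0; rewrite -/r in ri0.
have r0 : (0 < r)%N by rewrite ri0; case: (wf i0).
pose f i := count (fun u : atom R => asize u == i.+1) mu.
exists (mkseq f r); split=> [i|].
  have [ir|ri] := ltnP i r; first by rewrite nth_mkseq.
  rewrite nth_default ?size_mkseq //; apply/eqP; rewrite -leqn0 leqNgt -has_count.
  apply/negP => /(@has_tnthP _ _ _ (in_tuple mu))[j /eqP sj].
  have := bigop.leq_bigmax (F := sz) j; rewrite -/r /sz sj => h.
  by have := leq_trans h ri; rewrite ltnn.
rewrite -nth_last size_mkseq nth_mkseq ?prednK // /f prednK //.
apply/eqP; rewrite -lt0n -has_count; apply/(@has_tnthP _ _ _ (in_tuple mu)).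
by clearbody r; exists i0; rewrite ri0.
Qed.

(** [nth] past the end of m is 0, so a type of length at most 1 leaves only atoms of size 1; these
    commute and would equate the moments at X^2Y^2 and XYXY. *)
Lemma nc_type_size (R : realType) (mu : seq (atom R)) (beta : word -> R) m :
  nc_sequence beta -> represents mu beta -> has_type mu m -> (1 < size m)%N.
Proof.
move=> hnc [wf _ rep] [hm _]; rewrite ltnNge; apply/negP => sm; apply: hnc.
rewrite (rep [:: lX; lX; lY; lY] isT) (rep [:: lX; lY; lX; lY] isT) [LHS]big_tnth [RHS]big_tnth.
apply: eq_bigr => i _; congr (_ * _).
have : asize (tnth (in_tuple mu) i) = 1%N.
  case: (wf i) => s0 _ _ _; apply/eqP; rewrite eqn_leq s0 andbT leqNgt; apply/negP => s1.
  have : has (fun u : atom R => asize u == (asize (tnth (in_tuple mu) i)).-1.+1) mu.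
    by apply/(@has_tnthP _ _ _ (in_tuple mu)); exists i; rewrite prednK.
  by rewrite has_count hm nth_default // (leq_trans sm) // -ltnS prednK.
case: (tnth (in_tuple mu) i) => t w A B /= t1; move: A B; rewrite t1 => A B.
rewrite (mx11_scalar A) (mx11_scalar B) !mulmx1 -!scalar_mxM; congr (ntr _%:M); ring.
Qed.

(* The cardinality of the variety may be infinite; the last condition says that a set with
   \rank L elements injects into it. *)
Theorem corollary7p6 (R : realType) (beta : word -> R)
  (hbeta : moment_sequence beta) (hnorm : normalized beta)
  (hnc : nc_sequence beta) (hrank : \rank (M2 beta) = 6%N)
  (hrel : wcol (M2 beta) [:: lY; lY] =
          wcol (M2 beta) [::] - wcol (M2 beta) [:: lX; lX]) :
  admits_nc_measure beta <->
  exists a b c d e : R,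
    [/\ psd (Lmx beta a b c d e),
        psd (M2 beta - Lmx beta a b c d e),
        posdef (principal_submx [:: [::]; [:: lX]; [:: lY]; [:: lX; lY]]
                  (M2 beta - Lmx beta a b c d e)) &
        (`I_(\rank (Lmx beta a b c d e)) #<= variety (Lmx beta a b c d e))%card].
Proof.
have hb := M2_circle hbeta hrel; split.
  move=> [mu [m [[rep _ _] _]]].
  have [a [b [c [d [e [hL hD]]]]]] := represents_split hb rep.
  exists a, b, c, d, e; split=> //; first exact: nc_part_posdef.
  exact: rank_le_variety.
move=> [a [b [c [d [e [hL hD _ _]]]]]].
have [mu0 rep0] := psd_represents hb hnorm hnc hL hD.
have [m0 ty0] := represents_has_type rep0.
have [|m [mu [rep ty]] mmin] :=
    @ex_min_type (fun m => exists mu, represents mu beta /\ has_type mu m).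
  by exists m0, mu0.
exists mu, m; split; last exact: nc_type_size hnc rep ty.
by split=> // mu' m' rep' ty'; apply: mmin; exists mu'.
Qed.
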